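(* Let $d\ge 1$, let $\mu$ be a probability measure on $\mathbb{R}^d$ and let $p>0$. Assume that $M_q(\mu)<\infty$ for some $q>p$. Then there exists a constant $C$ depending only on $p,d,q$ such that, for all $N\geq 1$, $$ \mathbb{E}\left(\mathcal{T}_p(\mu_N,\mu)\right) \leq C\, M_q(\mu)^{p/q}\left\{\begin{array}{ll} N^{-1/2} +N^{-(q-p)/q}& \text{if } p>d/2 \text{ and } q\ne 2p, \\ N^{-1/2} \log(1+N)+N^{-(q-p)/q} & \text{if } p=d/2 \text{ and } q\ne 2p, \\ N^{-p/d}+N^{-(q-p)/q} & \text{if } p\in (0,d/2) \text{ and } q\ne dp/(d-p). \end{array}\right. $$
   Context: $(X_k)_{k\ge1}$ is an i.i.d. sequence of $\mathbb{R}^d$-valued random variables with law $\mu$, and $\mu_N:=\frac1N\sum_{k=1}^N\delta_{X_k}$ is the empirical measure. For $q>0$, $M_q(\mu):=\int_{\mathbb{R}^d}|x|^q\,\mu(dx)$, where $|\cdot|$ is the Euclidean norm. For $p>0$ and probability measures $\mu,\nu$ on $\mathbb{R}^d$, $$\mathcal{T}_p(\mu,\nu)=\inf\left\{\int_{\mathbb{R}^d\times\mathbb{R}^d}|x-y|^p\,\xi(dx,dy)\;:\;\xi\in\mathcal{H}(\mu,\nu)\right\},$$ where $\mathcal{H}(\mu,\nu)$ is the set of all probability measures on $\mathbb{R}^d\times\mathbb{R}^d$ with marginals $\mu$ and $\nu$ (no $p$-th root is taken). *)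

(* Defs.v *)
From HB Require Import structures.
From mathcomp Require Import all_boot all_order all_algebra.
From mathcomp Require Import all_classical all_reals all_analysis.

Set Implicit Arguments.
Unset Strict Implicit.
Unset Printing Implicit Defensive.

Import Order.TTheory GRing.Theory Num.Theory.
Import numFieldNormedType.Exports.

Local Open Scope classical_set_scope.
Local Open Scope ring_scope.

(* The space R^d is [d.-tuple R], whose library sigma-algebra is the one
   generated by the coordinates, i.e. the Borel sigma-algebra of R^d. *)
Section euclidean.
Context {R : realType} {d : nat}.

Definition eucl_norm (x : d.-tuple R) : R :=
  Num.sqrt (\sum_(i < d) tnth x i ^+ 2).

Definition eucl_dist (x y : d.-tuple R) : R :=
  eucl_norm [tuple tnth x i - tnth y i | i < d].

Definition moment (q : R) (mu : {measure set (d.-tuple R) -> \bar R}) : \bar R :=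
  (\int[mu]_x (eucl_norm x `^ q)%:E)%E.

End euclidean.

(* Measures are only compared on measurable sets: their values elsewhere are
   irrelevant. *)
Definition same_measure {dT} {T : measurableType dT} {R : realType}
    (m1 m2 : set T -> \bar R) : Prop :=
  forall A, measurable A -> m1 A = m2 A.

Definition couplings {dT} {T : measurableType dT} {R : realType}
    (mu nu : {measure set T -> \bar R}) : set (probability (T * T)%type R) :=
  [set xi | same_measure (pushforward xi fst) mu /\
            same_measure (pushforward xi snd) nu].

Definition transport_cost {R : realType} {d : nat} (p : R)
    (mu nu : {measure set (d.-tuple R) -> \bar R}) : \bar R :=
  ereal_inf
    [set (\int[xi]_z (eucl_dist z.1 z.2 `^ p)%:E)%E | xi in couplings mu nu].

(* For [N = 0] this is the zero measure. *)
Definition empirical_measure {dT} {T : measurableType dT} (R : realType)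
    (x : nat -> T) (N : nat) : {measure set T -> \bar R} :=
  mscale (N%:R^-1)%:nng (msum (fun k => \d_(x k)) N).

Lemma empirical_measureE {dT} {T : measurableType dT} (R : realType)
    (x : nat -> T) (N : nat) (A : set T) :
  empirical_measure R x N A = ((N%:R^-1)%:E * \sum_(k < N) \d_(x k) A)%E.
Proof. by []. Qed.

Lemma empirical_measure_setT {dT} {T : measurableType dT} (R : realType)
    (x : nat -> T) (N : nat) :
  (0 < N)%N -> empirical_measure R x N setT = 1%E.
Proof.
move=> N0; rewrite empirical_measureE.
under eq_bigr do rewrite diracT.
rewrite sumEFin -EFinM sumr_const card_ord mulVf//.
by rewrite pnatr_eq0 -lt0n.
Qed.

(* Mutual independence: product rule along every finite set of indices. *)
Definition mutually_independent {dO dT} {O : measurableType dO}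
    {T : measurableType dT} {R : realType} (P : probability O R)
    (X : nat -> {RV P >-> T}) : Prop :=
  forall (s : seq nat) (A : nat -> set T),
    uniq s -> (forall k, measurable (A k)) ->
    P (\bigcap_(k in [set` s]) (X k @^-1` A k)) =
    (\prod_(k <- s) P (X k @^-1` A k))%E.

(* The sequence is indexed from 0. *)
Definition iid_with_law {dO dT} {O : measurableType dO}
    {T : measurableType dT} {R : realType} (P : probability O R)
    (X : nat -> {RV P >-> T}) (mu : probability T R) : Prop :=
  mutually_independent X /\
  forall k, same_measure (distribution P (X k)) mu.

(* Main.v *)
Require Import Defs.
From mathcomp Require Import all_boot all_order all_algebra.
From mathcomp Require Import all_classical all_reals all_analysis.
From HB Require Import structures.
From mathcomp Require Import measurable_realfun lra ring zify.

Set Implicit Arguments.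
Unset Strict Implicit.
Unset Printing Implicit Defensive.

Import Order.TTheory GRing.Theory Num.Theory.
Import numFieldNormedType.Exports.

Local Open Scope classical_set_scope.
Local Open Scope ring_scope.

(** The cost of transporting [mu_N] to [mu] is bounded by a weighted sum of the
    differences [|mu_N F - mu F|] over the cells [F] of a multiscale partition;
    the mean of each difference is then controlled by the variance of a
    frequency.

    Partition.  Let [s > 0] be a length scale with [M_q(mu) <= s ^ q].  The space
    is cut into the ball of radius [s], the shells where
    [s 2 ^ (n - 1) < |x| <= s 2 ^ n] for [1 <= n <= m], and the complement of the
    largest ball.  Each shell carries nested dyadic grids: at level [l] it has
    at most [(3 * 2 ^ l) ^ d] cells, of side [s 2 ^ (n - l)].

    Coupling.  The mass is matched greedily from the finest cells to the
    coarsest ones, then between different shells.  Matching inside a cell uses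
    up the lighter of the two masses, and so leaves over exactly the positive
    part of the difference of the two masses of the cell
    ([match_in_classes]).  Hence the mass that has to move inside a cell of
    level [l], at a cost of order [(s 2 ^ (n - l)) ^ p], is the discrepancy on
    its subcells ([greedy_coupling]).  The plan is a matrix indexed by the
    finitely many finest cells; a density that is constant on products of
    cells turns it into a coupling ([lift_plan]).  The result is
    [transport_cost_multiscale].

    Expectation.  If [F] has mass [a], the mean of [|mu_N F - a|] is at most the
    minimum of [2 a] and [sqrt (a / N)] ([mean_deviation_le], by pairwise
    independence).  By the Cauchy-Schwarz inequality and the Markov bound
    [mu (shell n) <= 2 ^ q * 2 ^ (- q n)], the sum over the cells of level [l]
    of the [n]-th shell is at most a constant times
    [min (2 ^ (- q n)) (2 ^ ((d l - q n) / 2) * N ^ (- 1 / 2))]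
    ([shell_deviation_le]).

    Summation.  With the weights [2 ^ (p n - p l)] there remains a double sum
    over [n] and [l] of minima of two geometric sequences.  When [q < 2 p] and
    [d (q - p) < p q], the sum over [n] is taken first; it is dominated by the
    point where the two sequences cross ([min_geom_sum_le]), and the result is
    of order [N ^ (- (q - p) / q)].  Otherwise [l] is summed first: the sum over [l] is a convergent geometric
    series if [p > d / 2], is dominated by its crossing point, of order
    [N ^ (- p / d)], if [p < d / 2], and has of the order of [log N] equal terms
    if [p = d / 2].  The excluded values of [q] are those for which the
    remaining series has ratio one.

    The bound obtained is a constant times [s ^ p] times the rate, and choosing
    [s = M_q(mu) ^ (1 / q)], or letting [s] tend to [0] if the moment vanishes,
    produces the factor [M_q(mu) ^ (p / q)] ([optimize_scale]). *)

(** * Greedy transport plans on a finite set *)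

Lemma pos_neg_part_sub (R : realDomainType) (x y : R) :
  Num.max (x - y) 0 - Num.max (y - x) 0 = x - y.
Proof. by rewrite -(opprB x y); have [|] := leP 0 (x - y) => h; case: leP; lra. Qed.

Lemma pos_neg_part_add (R : realDomainType) (x y : R) :
  Num.max (x - y) 0 + Num.max (y - x) 0 = `|x - y|.
Proof.
rewrite -(opprB x y); have [h|h] := leP 0 (x - y).
  by rewrite ger0_norm//; case: leP; lra.
by rewrite ltr0_norm//; case: leP; lra.
Qed.

Section greedy_plan.
Context {R : realFieldType} {J : finType}.
Implicit Types (a b D : J -> R) (w pi : J -> J -> R).

Definition class_mass (K : eqType) (f : J -> K) a (k : K) : R :=
  \sum_(i | f i == k) a i.

Lemma class_mass_ge0 (K : eqType) (f : J -> K) a k :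
  (forall i, 0 <= a i) -> 0 <= class_mass f a k.
Proof. by move=> a0; apply: sumr_ge0 => i _. Qed.

Lemma class_mass_comp (K L : finType) (f : J -> K) (g : K -> L) a l :
  class_mass (g \o f) a l = \sum_(k | g k == l) class_mass f a k.
Proof.
rewrite /class_mass (partition_big f (fun k => g k == l)) //=.
apply: eq_bigr => k gk; apply: eq_bigl => i.
by have [->|_] := eqVneq (f i) k; rewrite ?gk ?eqxx ?andbF ?andbT/=.
Qed.

Lemma sum_class_mass (K : finType) (f : J -> K) (E : K -> R) a :
  \sum_i E (f i) * a i = \sum_k E k * class_mass f a k.
Proof.
rewrite (partition_big f xpredT) //=; apply: eq_bigr => k _.
by rewrite mulr_sumr; apply: eq_bigr => i /eqP ->.
Qed.

(** Inside a class of mass [A] for [a] and [B] for [b], the pair [(i, j)]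
    receives [a i * b j / max A B].  This exhausts the lighter of the two
    marginals on the class, so that the mass left over is
    the positive part of [A - B]: it does not remember how [a] and [b] are
    spread inside the class. *)
Lemma match_in_classes (K : finType) (f : J -> K) a b :
  (forall i, 0 <= a i) -> (forall i, 0 <= b i) ->
  exists pi : J -> J -> R, exists a' b' : J -> R,
  [/\ (forall i j, 0 <= pi i j) /\ (forall i j, f i != f j -> pi i j = 0),
      forall i, 0 <= a' i /\ \sum_j pi i j = a i - a' i,
      forall j, 0 <= b' j /\ \sum_i pi i j = b j - b' j &
      forall k,
        class_mass f a' k = Num.max (class_mass f a k - class_mass f b k) 0 /\
        class_mass f b' k = Num.max (class_mass f b k - class_mass f a k) 0].
Proof.
move=> a0 b0.
pose A := class_mass f a; pose B := class_mass f b.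
have A0 k : 0 <= A k by exact: class_mass_ge0.
have B0 k : 0 <= B k by exact: class_mass_ge0.
pose M k := Num.max (A k) (B k).
have M0 k : 0 <= M k by rewrite le_max A0.
have le1 x k : 0 <= x -> x <= M k -> x / M k <= 1.
  move=> x0 xM; have := M0 k; rewrite le_eqVlt => /predU1P[<-|Mk].
    by rewrite invr0 mulr0.
  by rewrite ler_pdivrMr ?mul1r.
exists (fun i j => if f i == f j then a i * b j / M (f i) else 0).
exists (fun i => a i - a i * (B (f i) / M (f i))).
exists (fun j => b j - b j * (A (f j) / M (f j))).
split.
- split=> [i j|i j /negbTE -> //]; case: ifP => // _.
  by rewrite mulr_ge0 ?invr_ge0 ?mulr_ge0.
- move=> i; split.
    by rewrite subr_ge0 ler_piMr// le1// le_max lexx orbT.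
  rewrite -big_mkcond/= opprB addrCA subrr addr0 mulrA /B/class_mass mulr_sumr mulr_suml.
  by apply: eq_bigl => j; rewrite eq_sym.
- move=> j; split.
    by rewrite subr_ge0 ler_piMr// le1// le_max lexx.
  rewrite -big_mkcond/= opprB addrCA subrr addr0 mulrA /A/class_mass mulr_sumr mulr_suml.
  by apply: eq_bigr => i /eqP ->; rewrite [a i * _]mulrC.
- move=> k.
  have E (c : J -> R) (X : K -> R) : class_mass f (fun i => c i - c i * (X (f i) / M (f i))) k
        = class_mass f c k - class_mass f c k * X k / M k.
    rewrite /class_mass big_split/= sumrN; congr (_ - _).
    by rewrite -mulrA mulr_suml; apply: eq_bigr => i /eqP ->.
  rewrite !E -/(A k) -/(B k) /M; have := A0 k; have := B0 k.
  set x := A k; set y := B k => y0 x0.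
  have [xy|yx] := leP x y.
    have [->|yn0] := eqVneq y 0.
      by split; have [] := leP; rewrite ?invr0; lra.
    by split; have [] := leP; rewrite ?mulfK// ?(mulrC y) ?mulfK//; lra.
  have xn0 : x != 0 by rewrite gt_eqF// (le_lt_trans y0).
  by split; have [] := leP; rewrite ?mulfK// ?(mulrC x) ?mulfK//; lra.
Qed.

(** The plan is built from the finest partition [f 0] to coarser and coarser
    ones, each step matching what the previous one left over.  The mass that
    reaches step [k.+1] in a class of [f k] is the discrepancy of [a] and [b]
    on this class, and it is moved at a cost [D k.+1] that only depends on the
    class. *)
Lemma greedy_plan (K : finType) (f : nat -> J -> K) (g : nat -> K -> K)
    (D : nat -> J -> R) (E : nat -> K -> R) w a b :
  (forall k, f k.+1 =1 g k \o f k) ->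
  (forall k i, 0 <= D k i) -> (forall k i, D k.+1 i = E k (f k i)) ->
  (forall i, 0 <= a i) -> (forall i, 0 <= b i) ->
  forall n, (forall k i j, (k <= n)%N -> f k i = f k j -> w i j <= D k i + D k j) ->
  exists pi : J -> J -> R, exists a' b' : J -> R,
  [/\ forall i j, 0 <= pi i j,
      forall i, 0 <= a' i /\ \sum_j pi i j = a i - a' i,
      forall j, 0 <= b' j /\ \sum_i pi i j = b j - b' j,
      forall k,
        class_mass (f n) a' k =
          Num.max (class_mass (f n) a k - class_mass (f n) b k) 0 /\
        class_mass (f n) b' k =
          Num.max (class_mass (f n) b k - class_mass (f n) a k) 0 &
      \sum_i \sum_j pi i j * w i j <= \sum_i D 0 i * (a i + b i) +
        \sum_(k < n) \sum_c E k c * `|class_mass (f k) a c - class_mass (f k) b c|].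
Proof.
move=> fg D0 DE a0 b0.
(* cost of one matching step, whatever is being matched *)
have step k (x y : J -> R) pi x' y' :
    (forall i j, f k i = f k j -> w i j <= D k i + D k j) ->
    (forall i j, 0 <= pi i j) -> (forall i j, f k i != f k j -> pi i j = 0) ->
    (forall i, 0 <= x' i /\ \sum_j pi i j = x i - x' i) ->
    (forall j, 0 <= y' j /\ \sum_i pi i j = y j - y' j) ->
    \sum_i \sum_j pi i j * w i j <= \sum_i D k i * (x i + y i).
  move=> wD pi0 pif px py.
  apply: (@le_trans _ _ (\sum_i \sum_j pi i j * (D k i + D k j))).
    apply: ler_sum => i _; apply: ler_sum => j _.
    have [e|ne] := eqVneq (f k i) (f k j); last by rewrite (pif _ _ ne) !mul0r.
    by rewrite ler_wpM2l// wD.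
  rewrite (eq_bigr (fun i => D k i * \sum_j pi i j + \sum_j pi i j * D k j)); last first.
    move=> i _; rewrite mulr_sumr -big_split/=; apply: eq_bigr => j _.
    by rewrite mulrDr mulrC.
  rewrite big_split/= [X in _ + X]exchange_big/= -big_split/=.
  apply: ler_sum => i _; rewrite -mulr_suml [X in _ + X]mulrC -mulrDr.
  apply: ler_wpM2l => //.
  by have [? ->] := px i; have [? ->] := py i; lra.
elim=> [|n IH] wD.
  have [pi [a' [b' [[pi0 pif] pa pb pr]]]] := match_in_classes (f 0) a0 b0.
  exists pi, a', b'; split=> //; rewrite big_ord0 addr0.
  exact: (step 0%N a b pi a' b' (fun i j => wD 0%N i j isT)).
have [|pi [a' [b' [pi0 pa pb pr pc]]]] := IH.
  by move=> k i j kn; apply: wD; rewrite ltnW.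
have [||rho [a2 [b2 [[rho0 rhof] ra rb rr]]]] := match_in_classes (f n.+1) (a := a') (b := b').
- by move=> i; case: (pa i).
- by move=> i; case: (pb i).
exists (fun i j => pi i j + rho i j), a2, b2; split.
- by move=> i j; rewrite addr_ge0.
- move=> i; case: (ra i) => ? e; split=> //.
  by rewrite big_split/= e; case: (pa i) => _ ->; lra.
- move=> i; case: (rb i) => ? e; split=> //.
  by rewrite big_split/= e; case: (pb i) => _ ->; lra.
- move=> k.
  (* matching inside finer classes does not change the discrepancy of a class *)
  have mE c : class_mass (f n.+1) c k = \sum_(l | g n l == k) class_mass (f n) c l.
    rewrite -class_mass_comp /class_mass; apply: eq_bigl => i.
    by rewrite fg.
  have dif : class_mass (f n.+1) a' k - class_mass (f n.+1) b' k =
             class_mass (f n.+1) a k - class_mass (f n.+1) b k.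
    rewrite !mE -!sumrB; apply: eq_bigr => l _.
    by have [-> ->] := pr l; rewrite pos_neg_part_sub.
  have [-> ->] := rr k.
  by rewrite dif -[in class_mass _ b' k - _]opprB dif opprB.
- rewrite big_ord_recr/= addrA.
  rewrite (eq_bigr (fun i => \sum_j pi i j * w i j + \sum_j rho i j * w i j)); last first.
    by move=> i _; rewrite -big_split/=; apply: eq_bigr => j _; rewrite mulrDl.
  rewrite big_split/=; apply: lerD => //.
  apply: (le_trans (step n.+1 a' b' rho a2 b2 _ _ _ _ _)) => //.
    by move=> i j; apply: wD.
  rewrite (eq_bigr (fun i => E n (f n i) * (a' i + b' i))); last first.
    by move=> i _; rewrite DE.
  rewrite (sum_class_mass (f n) (E n) (fun i => a' i + b' i)).
  apply: ler_sum => c _; rewrite le_eqVlt; apply/orP; left; apply/eqP; congr (_ * _).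
  rewrite /class_mass big_split/= -!/(class_mass _ _ _).
  have [-> ->] := pr c; set x := class_mass _ a _; set y := class_mass _ b _.
  by rewrite pos_neg_part_add.
Qed.

(** Once the last partition is trivial, equal total masses leave nothing
    over. *)
Lemma greedy_coupling (K : finType) (f : nat -> J -> K) (g : nat -> K -> K)
    (D : nat -> J -> R) (E : nat -> K -> R) w a b n k0 :
  (forall k, f k.+1 =1 g k \o f k) -> (forall i, f n i = k0) ->
  (forall k i, 0 <= D k i) -> (forall k i, D k.+1 i = E k (f k i)) ->
  (forall i, 0 <= a i) -> (forall i, 0 <= b i) -> \sum_i a i = \sum_i b i ->
  (forall k i j, (k <= n)%N -> f k i = f k j -> w i j <= D k i + D k j) ->
  exists pi : J -> J -> R,
  [/\ forall i j, 0 <= pi i j,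
      forall i, \sum_j pi i j = a i,
      forall j, \sum_i pi i j = b j &
      \sum_i \sum_j pi i j * w i j <= \sum_i D 0 i * (a i + b i) +
        \sum_(k < n) \sum_c E k c * `|class_mass (f k) a c - class_mass (f k) b c|].
Proof.
move=> fg fn D0 DE a0 b0 ab wD.
have [pi [a' [b' [pi0 pa pb pr pc]]]] := greedy_plan fg D0 DE a0 b0 wD.
have tot c : class_mass (f n) c k0 = \sum_i c i.
  by apply: eq_bigl => i; rewrite fn eqxx.
have [] := pr k0; rewrite !tot ab subrr maxxx => sa sb.
have a'0 i : a' i = 0.
  by apply: (psumr_eq0P _ sa) => // j _; case: (pa j).
have b'0 i : b' i = 0.
  by apply: (psumr_eq0P _ sb) => // j _; case: (pb j).
exists pi; split=> // i.
  by case: (pa i) => _ ->; rewrite a'0 subr0.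
by case: (pb i) => _ ->; rewrite b'0 subr0.
Qed.

End greedy_plan.

(** * From plans between cells to couplings *)

(** The integral of a nonnegative function is a supremum over the simple
    functions below it; hence monotonicity needs no measurability, and the
    transport cost may be integrated even if it is not known to be measurable. *)
Lemma ge0_le_lower_integral dT (T : measurableType dT) (R : realType)
    (mu : {measure set T -> \bar R}) (f g : T -> \bar R) :
  (forall x, 0 <= f x)%E -> (forall x, f x <= g x)%E ->
  (\int[mu]_x f x <= \int[mu]_x g x)%E.
Proof.
move=> f0 fg; rewrite !ge0_integralTE// => [|x]; last exact: le_trans (fg x).
apply: le_ereal_sup => _ [h hf <-]; exists h => // x.
exact: le_trans (fg x).
Qed.

Lemma measure_fibers dT (T : measurableType dT) (R : realType)
    (mu : {measure set T -> \bar R}) (J : finType) (f : T -> J) (X : set T)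
    (mf : forall i, measurable (f @^-1` [set i])) (mX : measurable X)
    (Q : pred J) :
  mu (X `&` [set x | Q (f x)]) = (\sum_(i | Q i) mu (X `&` f @^-1` [set i]))%E.
Proof.
rewrite bigfs; first last.
- by move=> i _; rewrite mem_index_enum.
- exact: index_enum_uniq.
rewrite -measure_fin_bigcup//; first last.
- by move=> i _; exact: measurableI.
- apply/trivIsetP => i j _ _ /eqP ij; rewrite -subset0 => x [[_ /= fi] [_ /= fj]].
  by apply: ij; rewrite -fi -fj.
congr (mu _); apply/seteqP; split => [x [Xx /= Qfx]|x [i /= Qi [Xx /= fi]]].
  by exists (f x).
by split=> //=; rewrite fi.
Qed.

Section lift_plan.
Context {d1 d2 : measure_display} {T1 : measurableType d1} {T2 : measurableType d2}.
Context {R : realType} (nu : probability T1 R) (mu : probability T2 R).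
Context {J1 J2 : finType} (f : T1 -> J1) (g : T2 -> J2).
Hypothesis mf : forall i, measurable (f @^-1` [set i]).
Hypothesis mg : forall j, measurable (g @^-1` [set j]).
Variable pi : J1 -> J2 -> R.
Hypothesis pi0 : forall i j, 0 <= pi i j.
Hypothesis pi_row : forall i, (\sum_j pi i j)%:E = nu (f @^-1` [set i]).
Hypothesis pi_col : forall j, (\sum_i pi i j)%:E = mu (g @^-1` [set j]).

Let A i := f @^-1` [set i].
Let B j := g @^-1` [set j].
Let mA i : measurable (A i). Proof. exact: mf. Qed.
Let mB j : measurable (B j). Proof. exact: mg. Qed.
Let a i : R := \sum_j pi i j.
Let b j : R := \sum_i pi i j.

Let coef_ge0 (k : J1 * J2) : 0 <= pi k.1 k.2 / (a k.1 * b k.2).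
Proof. by rewrite divr_ge0// mulr_ge0// sumr_ge0. Qed.

Let coef (k : J1 * J2) : {nonneg R} := NngNum (coef_ge0 k).

Let mAB (k : J1 * J2) : measurable (A k.1 `*` B k.2).
Proof. exact: measurableX. Qed.

Let piece (k : J1 * J2) : {measure set (T1 * T2) -> \bar R} :=
  mscale (coef k) (mrestr (nu \x mu)%E (mAB k)).

Let k0_ex : exists k0 : J1 * J2, True.
Proof.
have ne dT (T : measurableType dT) (P : probability T R) : exists x : T, True.
  apply: contrapT => /forallNP h; have := probability_setT P.
  rewrite (_ : setT = set0) ?measure0; last first.
    by apply/seteqP; split=> x // _; exact: (h x).
  by move=> /eqP; rewrite eq_sym onee_eq0.
by have [x _] := ne _ _ nu; have [y _] := ne _ _ mu; exists (f x, g y).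
Qed.

Let k0 := projT1 (cid k0_ex).

Let xi : set (T1 * T2) -> \bar R :=
  msum (fun n => piece (nth k0 (index_enum (J1 * J2)%type) n))
    (size (index_enum (J1 * J2)%type)).
HB.instance Definition _ := Measure.on xi.

Let xiE S : xi S = (\sum_(k : J1 * J2) (pi k.1 k.2 / (a k.1 * b k.2))%:E *
   (nu \x mu) (S `&` (A k.1 `*` B k.2)))%E.
Proof.
rewrite [LHS](_ : _ = \sum_(n < size (index_enum (J1 * J2)%type))
  piece (nth k0 (index_enum (J1 * J2)%type) n) S)%E//.
by rewrite [RHS](big_nth k0) big_mkord.
Qed.

Let xi_rect X Y : measurable X -> measurable Y ->
  xi (X `*` Y) = (\sum_i \sum_j (pi i j / (a i * b j))%:E *
   (nu (X `&` A i) * mu (Y `&` B j)))%E.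
Proof.
move=> mX mY; rewrite xiE pair_bigA/=; apply: eq_bigr => k _.
congr (_ * _)%E; rewrite -setXI.
by rewrite product_measure1E//; exact: measurableI.
Qed.

Let nu_fibers X : measurable X -> (\sum_i nu (X `&` A i) = nu X)%E.
Proof.
move=> mX; rewrite -(measure_fibers nu mf mX xpredT).
by congr (nu _); apply/seteqP; split => [x []|x].
Qed.

Let mu_fibers Y : measurable Y -> (\sum_j mu (Y `&` B j) = mu Y)%E.
Proof.
move=> mY; rewrite -(measure_fibers mu mg mY xpredT).
by congr (mu _); apply/seteqP; split => [x []|x].
Qed.

Let a_eq0 i j : a i = 0 -> pi i j = 0.
Proof. by move=> /psumr_eq0P -> // k _. Qed.

Let b_eq0 i j : b j = 0 -> pi i j = 0.
Proof. by move=> /psumr_eq0P -> // k _. Qed.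

Let xi_fst X : measurable X -> xi (X `*` setT) = nu X.
Proof.
move=> mX; rewrite xi_rect//.
rewrite -[RHS]nu_fibers//; apply: eq_bigr => i _.
under eq_bigr do rewrite setTI.
have fin : nu (X `&` A i) \is a fin_num by rewrite fin_num_measure//; exact: measurableI.
rewrite -(fineK fin) (eq_bigr (fun j => (pi i j / a i * fine (nu (X `&` A i)))%:E)); last first.
  move=> j _; rewrite /B -pi_col -!EFinM; congr _%:E; rewrite -/(b j).
  have [bj|bj] := eqVneq (b j) 0; first by rewrite (b_eq0 i bj) !mul0r.
  have [ai|ai] := eqVneq (a i) 0; first by rewrite (a_eq0 j ai) !mul0r.
  by field; rewrite ai bj.
rewrite sumEFin -mulr_suml -mulr_suml -/(a i).
have [ai|ai] := eqVneq (a i) 0; last by rewrite divff// mul1r.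
congr _%:E; rewrite ai mul0r mul0r; apply/esym.
have : (nu (X `&` A i) <= nu (A i))%E.
  by apply: le_measure; rewrite ?inE//; exact: measurableI.
rewrite /A -pi_row -/(a i) ai => h.
have /eqP -> : nu (X `&` A i) == 0%E by rewrite eq_le h measure_ge0.
by [].
Qed.

Let xi_snd Y : measurable Y -> xi (setT `*` Y) = mu Y.
Proof.
move=> mY; rewrite xi_rect// exchange_big/=.
rewrite -[RHS]mu_fibers//; apply: eq_bigr => j _.
under eq_bigr do rewrite setTI.
have fin : mu (Y `&` B j) \is a fin_num by rewrite fin_num_measure//; exact: measurableI.
rewrite -(fineK fin) (eq_bigr (fun i => (pi i j / b j * fine (mu (Y `&` B j)))%:E)); last first.
  move=> i _; rewrite /A -pi_row -!EFinM; congr _%:E; rewrite -/(a i).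
  have [bj|bj] := eqVneq (b j) 0; first by rewrite (b_eq0 i bj) !mul0r.
  have [ai|ai] := eqVneq (a i) 0; first by rewrite (a_eq0 j ai) !mul0r.
  by field; rewrite ai bj.
rewrite sumEFin -mulr_suml -mulr_suml -/(b j).
have [bj|bj] := eqVneq (b j) 0; last by rewrite divff// mul1r.
congr _%:E; rewrite bj mul0r mul0r; apply/esym.
have : (mu (Y `&` B j) <= mu (B j))%E.
  by apply: le_measure; rewrite ?inE//; exact: measurableI.
rewrite /B -pi_col -/(b j) bj => h.
have /eqP -> : mu (Y `&` B j) == 0%E by rewrite eq_le h measure_ge0.
by [].
Qed.

Let xi_cell i j : xi (A i `*` B j) = (pi i j)%:E.
Proof.
rewrite xi_rect// (bigD1 i)//= (bigD1 j)//= !setIid [X in (_ + X + _)%E]big1; last first.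
  move=> j' j'j; rewrite [B j `&` B j'](_ : _ = set0) ?measure0 ?mule0//.
  by rewrite -subset0 => x [/= e /= e']; rewrite -e -e' eqxx in j'j.
rewrite [X in (_ + X)%E]big1; last first.
  move=> i' i'i; rewrite big1// => j' _; rewrite [A i `&` A i'](_ : _ = set0) ?measure0 ?mul0e ?mule0//.
  by rewrite -subset0 => x [/= e /= e']; rewrite -e -e' eqxx in i'i.
rewrite !adde0 /A /B -pi_row -pi_col -!EFinM; congr _%:E; rewrite -/(a i) -/(b j).
have [bj|bj] := eqVneq (b j) 0; first by rewrite (b_eq0 i bj) !mul0r.
have [ai|ai] := eqVneq (a i) 0; first by rewrite (a_eq0 j ai) !mul0r.
by rewrite divfK// mulf_neq0.
Qed.

(** The density of the coupling with respect to the product measure is constant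
    on the product of two cells. *)
Lemma lift_plan : exists2 xi : probability (T1 * T2)%type R,
  same_measure (pushforward xi fst) nu /\ same_measure (pushforward xi snd) mu &
  forall i j, xi (A i `*` B j) = (pi i j)%:E.
Proof.
have xi1 : xi setT = 1%E by rewrite -setXTT xi_fst// probability_setT.
pose m := Measure_isProbability.Build _ _ _ xi xi1.
pose xi' : probability (T1 * T2)%type R := HB.pack xi m.
exists xi'; last exact: xi_cell.
split=> X mX.
  by rewrite -[RHS]xi_fst//; congr (xi _); apply/seteqP; split => [x ?|x []].
by rewrite -[RHS]xi_snd//; congr (xi _); apply/seteqP; split => [x ?|x []].
Qed.

End lift_plan.

Section coupling_cost.
Context {d1 d2 : measure_display} {T1 : measurableType d1} {T2 : measurableType d2}.
Context {R : realType} (nu : probability T1 R) (mu : probability T2 R).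
Context {J1 J2 : finType} (f : T1 -> J1) (g : T2 -> J2).
Hypothesis mf : forall i, measurable (f @^-1` [set i]).
Hypothesis mg : forall j, measurable (g @^-1` [set j]).

Let integral_cells (xi : {measure set (T1 * T2) -> \bar R}) (pi w : J1 -> J2 -> R) :
  (forall i j, 0 <= w i j) ->
  (forall i j, xi ((f @^-1` [set i]) `*` (g @^-1` [set j])) = (pi i j)%:E) ->
  measurable_fun setT (EFin \o (fun z : T1 * T2 => w (f z.1) (g z.2))) /\
  (\int[xi]_z (w (f z.1) (g z.2))%:E = (\sum_i \sum_j pi i j * w i j)%:E)%E.
Proof.
move=> w0 xiE.
pose ind (k : J1 * J2) : T1 * T2 -> \bar R := (fun z =>
  (w k.1 k.2)%:E * (\1_((f @^-1` [set k.1]) `*` (g @^-1` [set k.2])) z)%:E)%E.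
have mC (k : J1 * J2) : measurable ((f @^-1` [set k.1]) `*` (g @^-1` [set k.2])).
  exact: measurableX.
have mind k : measurable_fun setT (ind k).
  by apply: emeasurable_funM => //; apply/measurable_EFinP; exact: measurable_indic.
have indE : (EFin \o (fun z => w (f z.1) (g z.2))) = (fun z => \sum_k ind k z)%E.
  apply/funext => z; rewrite (bigD1 (f z.1, g z.2))//= big1.
    by rewrite /ind/= indicE mem_set// mule1 adde0.
  move=> -[i j] /eqP ij; rewrite /ind/= indicE memNset ?mule0//= => -[/= fi gj].
  by apply: ij; rewrite fi gj.
rewrite indE; split; first exact: emeasurable_sum.
rewrite (eq_integral (fun z => \sum_k ind k z)%E); last by move=> z _; rewrite -(congr1 (@^~ z) indE).
rewrite ge0_integral_sum//; last first.
  by move=> k z _; rewrite /ind -EFinM lee_fin mulr_ge0.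
rewrite pair_bigA/= -sumEFin; apply: eq_bigr => k _.
rewrite ge0_integralZl_EFin//; last first.
  by apply/measurable_EFinP; exact: measurable_indic.
by rewrite integral_indic// setIT xiE muleC.
Qed.

(** The functions [h1] and [h2] take care of the cells that are too large for the
    cost between two of them to be bounded. *)
Lemma coupling_cost_le (pi w : J1 -> J2 -> R) (c : T1 * T2 -> R)
    (h1 : T1 -> R) (h2 : T2 -> R) :
  (forall i j, 0 <= pi i j) ->
  (forall i, (\sum_j pi i j)%:E = nu (f @^-1` [set i])) ->
  (forall j, (\sum_i pi i j)%:E = mu (g @^-1` [set j])) ->
  (forall i j, 0 <= w i j) -> (forall z, 0 <= c z) ->
  (forall x, 0 <= h1 x) -> (forall y, 0 <= h2 y) ->
  measurable_fun setT h1 -> measurable_fun setT h2 ->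
  (forall z, c z <= w (f z.1) (g z.2) + h1 z.1 + h2 z.2) ->
  exists2 xi : probability (T1 * T2)%type R,
    same_measure (pushforward xi fst) nu /\ same_measure (pushforward xi snd) mu &
    (\int[xi]_z (c z)%:E <= (\sum_i \sum_j pi i j * w i j)%:E +
      \int[nu]_x (h1 x)%:E + \int[mu]_y (h2 y)%:E)%E.
Proof.
move=> pi0 row col w0 c0 h10 h20 mh1 mh2 ch.
have [xi [xi1 xi2] xiE] := lift_plan mf mg pi0 row col.
exists xi => //.
have [mW intW] := integral_cells w0 xiE.
have mh1' : measurable_fun setT (EFin \o (fun z : T1 * T2 => h1 z.1)).
  by apply/measurable_EFinP; exact: (measurableT_comp mh1).
have mh2' : measurable_fun setT (EFin \o (fun z : T1 * T2 => h2 z.2)).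
  by apply/measurable_EFinP; exact: (measurableT_comp mh2).
apply: (@le_trans _ _ (\int[xi]_z
    ((w (f z.1) (g z.2))%:E + (h1 z.1)%:E + (h2 z.2)%:E))%E).
  by apply: ge0_le_lower_integral => z; rewrite ?lee_fin// -!EFinD lee_fin.
rewrite ge0_integralD//=; first last.
- by move=> z _; rewrite lee_fin.
- exact: emeasurable_funD.
- by move=> z _; rewrite -EFinD lee_fin addr_ge0.
rewrite ge0_integralD//=; last 2 first.
- by move=> z _; rewrite lee_fin.
- by move=> z _; rewrite lee_fin.
rewrite intW le_eqVlt; apply/orP; left; apply/eqP; congr (_ + _ + _)%E.
  have mh : measurable_fun setT (EFin \o h1) by exact/measurable_EFinP.
  have h0 : {in setT, forall x, 0 <= (EFin \o h1) x}%E by move=> x _; rewrite lee_fin.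
  have <- := ge0_integral_pushforward (@measurable_fst _ _ T1 T2) xi measurableT mh h0.
  by apply: eq_measure_integral => A mA _; exact: xi1.
have mh : measurable_fun setT (EFin \o h2) by exact/measurable_EFinP.
have h0 : {in setT, forall x, 0 <= (EFin \o h2) x}%E by move=> x _; rewrite lee_fin.
have <- := ge0_integral_pushforward (@measurable_snd _ _ T1 T2) xi measurableT mh h0.
by apply: eq_measure_integral => A mA _; exact: xi2.
Qed.

End coupling_cost.

Section empirical_probability.
Context {dT} {T : measurableType dT} {R : realType} (x : nat -> T) (N : nat).

Definition empirical_probability : set T -> \bar R := empirical_measure R x N.+1.

HB.instance Definition _ := Measure.on empirical_probability.

HB.instance Definition _ := Measure_isProbability.Build _ _ _
  empirical_probability (empirical_measure_setT R x (ltn0Sn N)).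

End empirical_probability.

(** * Shells and dyadic cells of the Euclidean space *)

Section euclidean_norm.
Context {R : realType} {d : nat}.
Implicit Types x y z : d.-tuple R.

Lemma eucl_norm_ge0 x : 0 <= eucl_norm x.
Proof. exact: sqrtr_ge0. Qed.

Lemma coord_le_eucl_norm x i : `|tnth x i| <= eucl_norm x.
Proof.
rewrite -sqrtr_sqr ler_wsqrtr// (bigD1 i)//= lerDl.
by apply: sumr_ge0 => j _; exact: sqr_ge0.
Qed.

Lemma eucl_norm_le z r : 0 <= r -> (forall i, `|tnth z i| <= r) ->
  eucl_norm z <= d%:R * r.
Proof.
move=> r0 zr; rewrite -[leRHS]ger0_norm ?mulr_ge0// -sqrtr_sqr ler_wsqrtr//.
apply: (@le_trans _ _ (\sum_(i < d) r ^+ 2)).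
  by apply: ler_sum => i _; rewrite -real_normK ?num_real// lerXn2r// nnegrE.
rewrite sumr_const card_ord -[leLHS]mulr_natl exprMn ler_wpM2r ?sqr_ge0//.
by rewrite -natrX ler_nat; case: (d) => // n; rewrite expnS expn1 leq_pmulr.
Qed.

Lemma eucl_dist_le x y r : 0 <= r -> (forall i, `|tnth x i - tnth y i| <= r) ->
  eucl_dist x y <= d%:R * r.
Proof. by move=> r0 xyr; apply: eucl_norm_le => // i; rewrite tnth_mktuple. Qed.

Lemma eucl_dist_le_norms x y r : eucl_norm x + eucl_norm y <= r ->
  eucl_dist x y <= d%:R * r.
Proof.
move=> xyr; apply: eucl_dist_le => [|i].
  by apply: le_trans xyr; rewrite addr_ge0// eucl_norm_ge0.
apply: le_trans (ler_normB _ _) (le_trans _ xyr).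
by rewrite lerD// coord_le_eucl_norm.
Qed.

Lemma measurable_eucl_norm : measurable_fun setT (@eucl_norm R d).
Proof.
apply: (@measurableT_comp _ _ _ _ _ _ (@Num.sqrt R)).
  exact: continuous_measurable_fun (@sqrt_continuous R).
apply: measurable_sum => i; apply: measurable_funX; exact: measurable_tnth.
Qed.

End euclidean_norm.

(** A label computed from a natural number is measurable as soon as the
    sublevel sets of this number are. *)
Lemma measurable_fiber_nat dT (T : measurableType dT) (J : Type) (f : T -> nat)
    (g : nat -> J) (j : J) :
  (forall n, measurable [set x | (f x <= n)%N]) -> measurable [set x | g (f x) = j].
Proof.
move=> mf; rewrite (_ : [set x | _] = \bigcup_(n in [set n | g n = j])
    ([set x | (f x <= n)%N] `\` [set x | (f x < n)%N])); last first.
  apply/seteqP; split => [x /= gx|x [n /= <- [/= le /negP]]].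
    by exists (f x) => //; split => //=; rewrite ltnn.
  by rewrite -leqNgt => ge; congr g; apply/eqP; rewrite eqn_leq le.
apply: bigcup_measurable => n _; apply: measurableD => //.
case: n => [|n]; last exact: mf.
by rewrite (_ : [set x | _] = set0)//; apply/seteqP; split.
Qed.

Section cells.
Context {R : realType} {d : nat} (s : R) (m : nat).
Hypothesis s0 : 0 < s.
Implicit Types x y : d.-tuple R.

Let radius n : R := s * 2 ^+ n.

Let radius_gt0 n : 0 < radius n.
Proof. by rewrite mulr_gt0// exprn_gt0. Qed.

(** The least [n <= m] such that [x] belongs to the ball of radius [s * 2 ^ n],
    and [m.+1] outside of the largest of these balls. *)
Definition shell x : nat :=
  find (fun n => eucl_norm x <= s * 2 ^+ n) (iota 0 m.+1).

Lemma shell_le x : (shell x <= m.+1)%N.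
Proof. by rewrite -[leqRHS](size_iota 0 m.+1) find_size. Qed.

Lemma shell_leE x n : (n <= m)%N -> (shell x <= n)%N = (eucl_norm x <= s * 2 ^+ n).
Proof.
move=> nm; apply/idP/idP => [sn|xn].
  have sm : (shell x < size (iota 0 m.+1))%N by rewrite size_iota; lia.
  have := nth_find 0%N (a := fun n => eucl_norm x <= s * 2 ^+ n) (s := iota 0 m.+1).
  rewrite has_find => /(_ sm); rewrite -/(shell x) nth_iota; last by lia.
  by rewrite add0n; move=> h; apply: le_trans h _; rewrite ler_pM2l// ler_weXn2l// ler1n.
rewrite (leqNgt (shell x)); apply/negP => ns.
have := before_find 0%N ns; rewrite nth_iota; last by lia.
by rewrite add0n xn.
Qed.

Definition grid (n : nat) (t : R) : 'I_(2 ^ m.+1).+1 :=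
  inord (Num.truncn (2 ^+ m * (1 + t / (s * 2 ^+ n)))).

Notation label_type := ('I_m.+2 * {ffun 'I_d -> 'I_(2 ^ m.+1).+1})%type.

(** The shell of a point together with its position in the finest dyadic grid of
    that shell, which has [2 ^ m.+1] cells per coordinate and an extra one for
    the right end point. *)
Definition label x : label_type :=
  (inord (shell x), [ffun i => grid (shell x) (tnth x i)]).

Lemma measurable_norm_ball (r : R) : measurable [set x : d.-tuple R | eucl_norm x <= r].
Proof.
have := @measurable_eucl_norm R d measurableT _ (measurable_itv `]-oo, r]).
by rewrite setTI; congr measurable; apply/seteqP; split => x; rewrite /= in_itv.
Qed.

Lemma measurable_label j : measurable (label @^-1` [set j]).
Proof.
case: j => a v.
have mshell n : measurable [set x | (shell x <= n)%N].
  have [nm|nm] := leqP n m.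
    by under eq_set do rewrite shell_leE//; exact: measurable_norm_ball.
  rewrite (_ : [set x | _] = setT)//; apply/seteqP; split => // x _ /=.
  exact: leq_trans (shell_le x) nm.
rewrite (_ : label @^-1` _ = [set x | inord (shell x) = a :> 'I_m.+2] `&`
  \bigcap_(i in [set: 'I_d]) [set x | grid a (tnth x i) = v i]); last first.
  apply/seteqP; split => x /=.
    case=> sa <-; split=> // i _ /=; rewrite ffunE.
    by rewrite -sa inordK// ltnS shell_le.
  case=> sa gv; congr pair => //; apply/ffunP => i; rewrite ffunE -gv//.
  by rewrite -sa inordK// ltnS shell_le.
apply: measurableI; first exact: (measurable_fiber_nat (fun n => inord n : 'I_m.+2)).
apply: fin_bigcap_measurable => // i _.
pose t x := 2 ^+ m * (1 + tnth x i / (s * 2 ^+ a)).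
apply: (@measurable_fiber_nat _ _ _ (fun x => Num.truncn (t x))
  (fun n => inord n : 'I_(2 ^ m.+1).+1)) => n.
have mt : measurable_fun setT t.
  apply: measurable_funM => //; apply: measurable_funD => //.
  by apply: measurable_funM => //; exact: measurable_tnth.
have := mt measurableT _ (measurable_itv `]-oo, n.+1%:R[).
rewrite setTI; congr measurable; apply/seteqP; split => x; rewrite /= in_itv/=.
  by rewrite truncn_le_nat.
by rewrite truncn_le_nat.
Qed.

(** [coarsen k] forgets the last [k] binary digits of the position in the grid;
    for [k > m] it forgets the shell as well. *)
Definition coarsen (k : nat) (c : label_type) : label_type :=
  if (k <= m)%N then (c.1, [ffun i => inord (c.2 i %/ 2 ^ k)])
  else (ord0, [ffun=> ord0]).

Definition coarsen_step (k : nat) (c : label_type) : label_type :=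
  if (k < m)%N then (c.1, [ffun i => inord (c.2 i %/ 2)]) else (ord0, [ffun=> ord0]).

Let divn_pow_lt k (i : 'I_(2 ^ m.+1).+1) : (i %/ 2 ^ k < (2 ^ m.+1).+1)%N.
Proof. exact: leq_ltn_trans (leq_div _ _) (ltn_ord i). Qed.

Lemma coarsenS k : coarsen k.+1 =1 coarsen_step k \o coarsen k.
Proof.
move=> c; rewrite /coarsen/= /coarsen_step; have [km|//] := ltnP k m.
rewrite ltnW//=; congr pair; apply/ffunP => i; rewrite !ffunE.
by rewrite inordK// -divnMA -expnSr.
Qed.

Lemma coarsen_top c : coarsen m.+1 c = (ord0, [ffun=> ord0]).
Proof. by rewrite /coarsen ltnn. Qed.

Let grid_range x i : (shell x <= m)%N ->
  0 <= 2 ^+ m * (1 + tnth x i / (s * 2 ^+ shell x)) <= 2 ^+ m.+1.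
Proof.
move=> xm; have xr : eucl_norm x <= radius (shell x) by rewrite -shell_leE.
have := le_trans (coord_le_eucl_norm x i) xr; rewrite ler_norml => /andP[h1 h2].
have lo : -1 <= tnth x i / (s * 2 ^+ shell x).
  by rewrite ler_pdivlMr ?radius_gt0// -/(radius _) mulN1r.
have hi : tnth x i / (s * 2 ^+ shell x) <= 1.
  by rewrite ler_pdivrMr ?radius_gt0// mul1r.
have p2 : 0 < 2 ^+ m :> R by rewrite exprn_gt0.
by rewrite exprSr ler_pM2l// mulr_ge0 ?(ltW p2)//=; lra.
Qed.

(** In units of the finest grid, two coordinates whose integer parts have the same
    quotient by [2 ^ k] differ by at most [2 ^ k]. *)
Lemma coarsen_dist x y k : (k <= m)%N -> (shell x <= m)%N ->
  coarsen k (label x) = coarsen k (label y) ->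
  eucl_dist x y <= d%:R * (s * 2 ^+ shell x * 2 ^+ k / 2 ^+ m).
Proof.
move=> km xm; rewrite /coarsen km/= => -[/(congr1 val)/=].
rewrite !inordK ?ltnS ?shell_le// => sxy /ffunP gxy.
have ym : (shell y <= m)%N by rewrite -sxy.
apply: eucl_dist_le => [|i].
  by rewrite divr_ge0 ?exprn_ge0// mulr_ge0 ?exprn_ge0// ltW// radius_gt0.
have /andP[] := grid_range i xm; have /andP[] := grid_range i ym.
have trunc_lt (t : R) : t <= 2 ^+ m.+1 -> (Num.truncn t < (2 ^ m.+1).+1)%N.
  move=> t2; rewrite ltnS truncn_le_nat; apply: le_lt_trans t2 _.
  by rewrite -natrX ltr_nat.
have := gxy i; rewrite !ffunE => /(congr1 val)/=.
rewrite [in LHS]inordK ?divn_pow_lt// [in RHS]inordK ?divn_pow_lt// /grid -sxy.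
set tx := 2 ^+ m * (1 + tnth x i / _).
set ty := 2 ^+ m * (1 + tnth y i / _) => + ty0 ty2 tx0 tx2.
rewrite inordK ?trunc_lt// inordK ?trunc_lt// => q.
have close (t u : R) : 0 <= t -> 0 <= u ->
    (Num.truncn t %/ 2 ^ k = Num.truncn u %/ 2 ^ k)%N -> t - u <= 2 ^+ k.
  move=> t0 u0 tu; have /andP[_ lt] := truncn_itv t0; have /andP[le _] := truncn_itv u0.
  have : ((Num.truncn t).+1 <= Num.truncn u + 2 ^ k)%N.
    rewrite (divn_eq (Num.truncn t) (2 ^ k)) (divn_eq (Num.truncn u) (2 ^ k)) tu.
    have : (Num.truncn t %% 2 ^ k < 2 ^ k)%N by rewrite ltn_mod expn_gt0.
    lia.
  by rewrite -(ler_nat R) natrD natrX; lra.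
have tE z : tnth z i = (2 ^+ m * (1 + tnth z i / (s * 2 ^+ shell x)) / 2 ^+ m - 1) * (s * 2 ^+ shell x).
  by field; rewrite !expf_neq0// gt_eqF.
have -> : tnth x i - tnth y i = (tx - ty) * (s * 2 ^+ shell x / 2 ^+ m).
  by rewrite (tE x) (tE y) -/tx -/ty; field; rewrite expf_neq0.
rewrite normrM [`|s * _ / _|]ger0_norm; last first.
  by rewrite divr_ge0 ?exprn_ge0// ltW// radius_gt0.
rewrite (_ : s * _ * _ / _ = 2 ^+ k * (s * 2 ^+ shell x / 2 ^+ m)); last by ring.
apply: ler_wpM2r; first by rewrite divr_ge0 ?exprn_ge0// ltW// radius_gt0.
by rewrite ler_norml close// andbT lerNl opprB close.
Qed.

End cells.

(** * Transport cost of a multiscale discrepancy *)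

Section multiscale_cost.
Context {R : realType} {d : nat} (p s : R) (m : nat).
Hypothesis p0 : 0 < p.
Hypothesis s0 : 0 < s.
Implicit Types x y : d.-tuple R.

Notation label_type := ('I_m.+2 * {ffun 'I_d -> 'I_(2 ^ m.+1).+1})%type.

Let rho : R := 2 `^ p.

Let rho_gt0 : 0 < rho. Proof. by rewrite powR_gt0. Qed.

Let rho_ge1 : 1 <= rho.
Proof. by rewrite -(powRr0 2) ler_powR ?ler1n// ltW. Qed.

Let powR_exp2 n : (2 ^+ n) `^ p = rho ^+ n.
Proof. by rewrite -powR_mulrn// -powRrM mulrC powRrM powR_mulrn ?powR_ge0. Qed.

Let ge0_powR (a b : R) : 0 <= a -> a <= b -> a `^ p <= b `^ p.
Proof.
by move=> a0 ab; rewrite ge0_ler_powR// ?nnegrE ?(ltW p0)//; exact: le_trans ab.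
Qed.

(** The geometric sequence [(2 d s 2 ^ n) ^ p] bounds the cost between two points
    of the [n]-th shell; the outermost shell is accounted for by [far_cost]
    instead. *)
Definition shell_cost (n : nat) : R :=
  if (n <= m)%N then 2 `^ p * d%:R `^ p * s `^ p * (2 `^ p) ^+ n else 0.

(** The mass left over by the cells of [coarsen k] moves inside the cells of
    [coarsen k.+1], which are twice as large; the cost is indexed by the
    former. *)
Definition cell_cost (k : nat) (c : label_type) : R :=
  shell_cost c.1 * (2 `^ p) ^+ k / (2 `^ p) ^+ m.

(** On the outermost shell, [(2 d |x|) ^ p] bounds the cost between [x] and any
    point whose norm is at most that of [x]. *)
Definition far_cost x : R :=
  2 `^ p * d%:R `^ p *
  (eucl_norm x `^ p * \1_[set y : d.-tuple R | s * 2 ^+ m < eucl_norm y] x).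

Lemma shell_cost_ge0 n : 0 <= shell_cost n.
Proof. by rewrite /shell_cost; case: ifP => // _; rewrite !mulr_ge0 ?exprn_ge0 ?powR_ge0. Qed.

Lemma cell_cost_ge0 k c : 0 <= cell_cost k c.
Proof. by rewrite !mulr_ge0 ?shell_cost_ge0 ?invr_ge0 ?exprn_ge0 ?powR_ge0. Qed.

Lemma far_cost_ge0 x : 0 <= far_cost x.
Proof. by rewrite !mulr_ge0 ?powR_ge0// indicE. Qed.

Lemma measurable_far_cost : measurable_fun setT far_cost.
Proof.
apply: measurable_funM => //; apply: measurable_funM.
  apply: (measurableT_comp (measurable_powR p)); exact: measurable_eucl_norm.
apply: measurable_indic; rewrite (_ : [set y | _] = ~` [set y | eucl_norm y <= s * 2 ^+ m]).
  exact: measurableC (measurable_norm_ball _).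
by apply/seteqP; split => y /=; rewrite ltNge => /negP.
Qed.

Let D (k : nat) (c : label_type) : R :=
  if k is k'.+1 then cell_cost k' (coarsen k' c) else shell_cost c.1 / rho ^+ m.

Let D_ge0 k c : 0 <= D k c.
Proof.
by case: k => [|k]; rewrite /D ?cell_cost_ge0// divr_ge0 ?shell_cost_ge0// exprn_ge0// ltW.
Qed.

Let inner (c : label_type) : bool := (c.1 <= m)%N.

(** Every partition that puts two cells in a common class bounds the cost between
    them; this is the least of these bounds. *)
Let w (i j : label_type) : R :=
  if inner i && inner j then
    \big[Num.min/D m.+1 i + D m.+1 j]_(k < m.+2 | coarsen k i == coarsen k j) (D k i + D k j)
  else 0.

Let w_ge0 i j : 0 <= w i j.
Proof.
rewrite /w; case: ifP => // _; apply: le_bigmin; first by rewrite addr_ge0.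
by move=> k _; rewrite addr_ge0.
Qed.

Let w_le k i j : (k <= m.+1)%N -> coarsen k i = coarsen k j -> w i j <= D k i + D k j.
Proof.
move=> km kij; rewrite /w; case: ifP => _; last by rewrite addr_ge0.
have lt : (k < m.+2)%N by [].
by apply: (bigmin_le_cond _ (j := Ordinal lt)); rewrite /= kij.
Qed.

Let w_sym i j : w i j = w j i.
Proof.
rewrite /w andbC; case: ifP => // _; rewrite [D m.+1 i + _]addrC.
by apply: eq_big => [k|k _]; [exact: eq_sym|exact: addrC].
Qed.

Let label_shell x : (label s m x).1 = shell s m x :> nat.
Proof. by rewrite /= inordK// ltnS shell_le. Qed.

Let shell_le_norm x : (shell s m x <= m)%N = (eucl_norm x <= s * 2 ^+ m).
Proof. by rewrite shell_leE. Qed.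

Let dist_far x y : (m < shell s m x)%N -> eucl_norm y <= eucl_norm x ->
  eucl_dist x y `^ p <= far_cost x.
Proof.
move=> mx yx; have fx : s * 2 ^+ m < eucl_norm x by rewrite ltNge -shell_le_norm -ltnNge.
rewrite /far_cost indicE mem_set// mulr1.
rewrite [2 `^ p * _]mulrC -mulrA -powRM ?eucl_norm_ge0// -powRM ?mulr_ge0 ?eucl_norm_ge0//.
by apply: ge0_powR (eucl_norm_ge0 _) _; apply: eucl_dist_le_norms; lra.
Qed.

Let dist_sym x y : eucl_dist x y = eucl_dist y x.
Proof.
rewrite /eucl_dist /eucl_norm; congr Num.sqrt; apply: eq_bigr => i _.
by rewrite !tnth_mktuple -sqrrN opprB.
Qed.

Let dist_cell x y k : (k <= m)%N -> (shell s m x <= m)%N ->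
  coarsen k (label s m x) = coarsen k (label s m y) ->
  rho * eucl_dist x y `^ p <= cell_cost k (label s m x).
Proof.
move=> km xm kxy; have := coarsen_dist s0 km xm kxy.
move=> /(ge0_powR (eucl_norm_ge0 _)); rewrite /cell_cost label_shell /shell_cost xm.
rewrite !(powRM, powR_exp2, powR_invn) ?exprn_ge0 ?invr_ge0 ?mulr_ge0 ?exprn_ge0 ?(ltW s0)//.
rewrite -powR_inv1 ?exprn_ge0// -powRrM mulN1r powRN powR_exp2 -/rho => h.
by apply: (le_trans (ler_wpM2l (ltW rho_gt0) h)); rewrite !mulrA.
Qed.

Let dist_shells x y : (shell s m x <= m)%N -> (shell s m y <= m)%N ->
  eucl_dist x y `^ p <= shell_cost (shell s m x) + shell_cost (shell s m y).
Proof.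
wlog xy : x y / (shell s m y <= shell s m x)%N.
  move=> h; have [|/ltnW] := leqP (shell s m y) (shell s m x); first exact: h.
  by move=> /h h' xm ym; rewrite dist_sym addrC; exact: h'.
move=> xm ym; apply: (@le_trans _ _ (shell_cost (shell s m x))); last first.
  by rewrite lerDl shell_cost_ge0.
rewrite /shell_cost xm.
have nx : eucl_norm x <= s * 2 ^+ shell s m x by rewrite -(shell_leE s0 _ xm).
have ny : eucl_norm y <= s * 2 ^+ shell s m x by rewrite -(shell_leE s0 _ xm).
have h : eucl_dist x y <= d%:R * (2 * (s * 2 ^+ shell s m x)).
  by apply: eucl_dist_le_norms; lra.
have := ge0_powR (eucl_norm_ge0 _) h.
rewrite !(powRM, powR_exp2) ?exprn_ge0 ?mulr_ge0 ?exprn_ge0 ?(ltW s0)//.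
by move=> /le_trans; apply; rewrite -/rho !mulrA [d%:R `^ p * rho]mulrC.
Qed.

Let dist_le x y :
  eucl_dist x y `^ p <= w (label s m x) (label s m y) + far_cost x + far_cost y.
Proof.
wlog yx : x y / eucl_norm y <= eucl_norm x.
  move=> h; have [|/ltW] := leP (eucl_norm y) (eucl_norm x); first exact: h.
  by move=> /h; rewrite dist_sym w_sym addrAC.
have [mx|xm] := ltnP m (shell s m x).
  apply: le_trans (dist_far mx yx) _.
  by rewrite -addrA addrCA lerDl addr_ge0 ?far_cost_ge0.
have ym : (shell s m y <= m)%N.
  by rewrite shell_le_norm; apply: le_trans yx _; rewrite -shell_le_norm.
rewrite -addrA; apply: ler_wpDr; first by rewrite addr_ge0 ?far_cost_ge0.
rewrite /w /inner !label_shell xm ym/=.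
have top : eucl_dist x y `^ p <= D m.+1 (label s m x) + D m.+1 (label s m y).
  rewrite /D /cell_cost /coarsen leqnn/= !inordK ?ltnS ?shell_le//.
  by rewrite !mulfK ?expf_neq0 ?gt_eqF//; exact: dist_shells.
apply: le_bigmin => // -[k /= km] /eqP kxy.
case: k km kxy => [|k] km kxy.
  apply: (@le_trans _ _ (D 0 (label s m x))); last by rewrite lerDl.
  have := dist_cell (leq0n m) xm kxy; rewrite /cell_cost expr0 mulr1 => h.
  by apply: le_trans h; rewrite ler_peMl ?powR_ge0.
have [km'|] := ltnP k m; last first.
  by move=> mk; have -> : k = m by lia.
apply: (@le_trans _ _ (D k.+1 (label s m x))); last by rewrite lerDl.
have := dist_cell km' xm kxy.
rewrite /D /cell_cost /coarsen (ltnW km')/= exprS -/rho mulrCA -!mulrA.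
by rewrite ler_pM2l// !mulrA.
Qed.

Definition cell_mass (l : set (d.-tuple R) -> \bar R) (c : label_type) : R :=
  fine (l (label s m @^-1` [set c])).

(** All the mass in a finest cell is moved at the cost of that cell; then, scale
    after scale, the discrepancy between the masses of the cells is moved inside
    the next larger ones. *)
Lemma transport_cost_multiscale (nu mu : probability (d.-tuple R) R) :
  (transport_cost p nu mu <=
    (\sum_(c : label_type) shell_cost c.1 / (2 `^ p) ^+ m * (cell_mass nu c + cell_mass mu c) +
     \sum_(k < m.+1) \sum_(c : label_type) cell_cost k c *
       `|class_mass (coarsen k) (cell_mass nu) c - class_mass (coarsen k) (cell_mass mu) c|)%:E +
    \int[nu]_x (far_cost x)%:E + \int[mu]_x (far_cost x)%:E)%E.
Proof.
pose mass := cell_mass.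
have mlab := @measurable_label R d s m s0.
have massE (l : probability (d.-tuple R) R) c : (mass l c)%:E = l (label s m @^-1` [set c]).
  by rewrite fineK// fin_num_measure//.
have mass_ge0 (l : probability (d.-tuple R) R) c : 0 <= mass l c by rewrite fine_ge0.
have mass1 (l : probability (d.-tuple R) R) : \sum_c mass l c = 1.
  apply: EFin_inj; rewrite -sumEFin.
  have := measure_fibers l mlab measurableT xpredT.
  rewrite (_ : setT `&` _ = setT); last by apply/seteqP; split.
  move=> e; apply: etrans (etrans (esym e) (@probability_setT _ _ _ l)).
  by apply: eq_bigr => c _; rewrite setTI massE.
have mass_eq : \sum_c mass nu c = \sum_c mass mu c by rewrite !mass1.
have [pi [pi_ge0 row col cost]] := greedy_coupling (@coarsenS d m) (@coarsen_top d m)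
  D_ge0 (fun _ _ => erefl) (mass_ge0 nu) (mass_ge0 mu) mass_eq w_le.
have row' c : (\sum_j pi c j)%:E = nu (label s m @^-1` [set c]) by rewrite row massE.
have col' c : (\sum_i pi i c)%:E = mu (label s m @^-1` [set c]) by rewrite col massE.
have [xi xiM xiC] := coupling_cost_le mlab mlab (c := fun z => eucl_dist z.1 z.2 `^ p)
  pi_ge0 row' col' w_ge0 (fun z => powR_ge0 _ _) far_cost_ge0 far_cost_ge0
  measurable_far_cost measurable_far_cost (fun z => dist_le z.1 z.2).
apply: (@le_trans _ _ (\int[xi]_z (eucl_dist z.1 z.2 `^ p)%:E)%E).
  by apply: ereal_inf_lbound; exists xi.
apply: le_trans xiC _; rewrite -!addeA leeD2r// lee_fin.
Qed.
End multiscale_cost.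

(** * Mean deviation of the empirical measure *)

Lemma integral_probability_cst dT (T : measurableType dT) (R : realType)
  (P : probability T R) (r : R) : (\int[P]_x r%:E = r%:E)%E.
Proof.
by rewrite integral_cst//; apply: etrans (mule1 _); congr (_ * _)%E;
  exact: probability_setT.
Qed.

Section empirical_deviation.
Context {dO dT : measure_display} {O : measurableType dO} {T : measurableType dT}.
Context {R : realType} (P : probability O R) (X : nat -> {RV P >-> T}).
Variables (mu : probability T R) (N : nat).
Hypothesis XP : iid_with_law X mu.
Hypothesis N0 : (0 < N)%N.

Definition frequency (F : set T) (w : O) : R :=
  N%:R^-1 * \sum_(k < N) \1_(X k @^-1` F) w.

Lemma empirical_measure_frequency F w :
  empirical_measure R (fun k => X k w) N F = (frequency F w)%:E.
Proof.
by rewrite empirical_measureE /frequency EFinM -sumEFin; congr (_ * _)%E.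
Qed.

Lemma frequency_ge0 F w : 0 <= frequency F w.
Proof.
by rewrite mulr_ge0// sumr_ge0// => k _; rewrite indicE.
Qed.

Variable F : set T.
Hypothesis mF : measurable F.

Let event k : set O := X k @^-1` F.

Let mE k : measurable (event k).
Proof. by rewrite -[event k]setTI; exact: measurable_funP. Qed.

Lemma measurable_frequency : measurable_fun setT (frequency F).
Proof.
apply: measurable_funM => //; apply: measurable_sum => k.
apply: measurable_indic; exact: mE.
Qed.

Let a : R := fine (mu F).

Let aE : mu F = a%:E. Proof. by rewrite fineK// fin_num_measure. Qed.

Let a_ge0 : 0 <= a. Proof. by rewrite fine_ge0. Qed.

Let P_event k : P (event k) = a%:E.
Proof. by rewrite -aE; exact: XP.2. Qed.

Let P_eventI k l : (P (event k `&` event l) <= ((k == l)%:R * a + a ^+ 2)%:E)%E.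
Proof.
have [->|kl] := eqVneq k l.
  by rewrite setIid P_event lee_fin mul1r lerDl sqr_ge0.
have u : uniq [:: k; l] by rewrite /= inE kl.
have := XP.1 [:: k; l] (fun=> F) u (fun=> mF).
rewrite !big_cons big_nil mule1 -!/(event _) !P_event -EFinM mul0r add0r expr2 => <-.
rewrite le_eqVlt; apply/orP; left; apply/eqP; congr (P _); apply/seteqP; split => w.
  by move=> [wk wl] i /=; rewrite !inE => /orP[] /eqP ->.
by move=> h; split; apply: (h _); rewrite /= !inE eqxx ?orbT.
Qed.

Let NR0 : N%:R != 0 :> R. Proof. by rewrite pnatr_eq0 -lt0n. Qed.

Lemma integral_frequency : (\int[P]_w (frequency F w)%:E = mu F)%E.
Proof.
pose f (k : 'I_N) w := (N%:R^-1%:E * (\1_(event k) w)%:E : \bar R)%E.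
have mf k : measurable_fun setT (f k).
  by apply: emeasurable_funM => //; apply/measurable_EFinP; exact: measurable_indic.
rewrite (eq_integral (fun w => \sum_k f k w)%E); last first.
  by move=> w _; rewrite /frequency mulr_sumr -sumEFin.
rewrite ge0_integral_sum//; last first.
  by move=> k w _; rewrite /f -EFinM lee_fin mulr_ge0// indicE.
rewrite (eq_bigr (fun=> (N%:R^-1 * a)%:E)); last first.
  move=> k _; rewrite ge0_integralZl_EFin//; last first.
    by apply/measurable_EFinP; exact: measurable_indic.
  by rewrite integral_indic// setIT EFinM; congr (_ * _)%E; exact: P_event.
by rewrite sumEFin sumr_const card_ord aE -[(_ * a) *+ N]mulr_natl mulrA divff// mul1r.
Qed.

Let integral_frequency_sqr :
  (\int[P]_w (frequency F w ^+ 2)%:E <= (a / N%:R + a ^+ 2)%:E)%E.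
Proof.
pose f (kl : 'I_N * 'I_N) w :=
  ((N%:R^-1 ^+ 2)%:E * (\1_(event kl.1 `&` event kl.2) w)%:E : \bar R)%E.
have mf k : measurable_fun setT (f k).
  apply: emeasurable_funM => //; apply/measurable_EFinP; apply: measurable_indic.
  exact: measurableI.
rewrite (eq_integral (fun w => \sum_k f k w)%E); last first.
  move=> w _; rewrite /frequency exprMn [X in _ * X]expr2 mulr_suml mulr_sumr.
  rewrite -[RHS](pair_bigA _ (fun k l => f (k, l) w))/= -sumEFin; apply: eq_bigr => k _.
  rewrite 2!mulr_sumr -sumEFin; apply: eq_bigr => l _.
  by rewrite /f indicI EFinM.
rewrite ge0_integral_sum//; last first.
  by move=> k w _; rewrite /f -EFinM lee_fin mulr_ge0 ?exprn_ge0// indicE.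
apply: (@le_trans _ _ (\sum_(kl : 'I_N * 'I_N)
    (N%:R^-1 ^+ 2 * ((kl.1 == kl.2)%:R * a + a ^+ 2))%:E)%E).
  apply: lee_sum => k _; rewrite ge0_integralZl_EFin//; last first.
    by apply/measurable_EFinP; apply: measurable_indic; exact: measurableI.
  have mI : measurable (event k.1 `&` event k.2) by exact: measurableI.
  rewrite integral_indic// setIT.
  rewrite [leRHS]EFinM; apply: lee_wpmul2l; first by rewrite lee_fin exprn_ge0.
  exact: P_eventI.
rewrite sumEFin lee_fin -mulr_sumr.
rewrite -(pair_bigA _ (fun k l : 'I_N => (k == l)%:R * a + a ^+ 2))/=.
rewrite (eq_bigr (fun=> a + N%:R * a ^+ 2)); last first.
  move=> k _; rewrite big_split/= sumr_const card_ord mulr_natl; congr (_ + _).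
  by rewrite (bigD1 k)//= eqxx mul1r big1 ?addr0// => l /negbTE; rewrite eq_sym => ->; rewrite mul0r.
rewrite sumr_const card_ord -[(_ + _) *+ N]mulr_natl le_eqVlt; apply/orP; left; apply/eqP.
by field.
Qed.

(** Expanding the square makes all the integrands nonnegative once the cross
    term is moved to the other side. *)
Let variance_frequency :
  (\int[P]_w ((frequency F w - a) ^+ 2)%:E <= (a / N%:R)%:E)%E.
Proof.
have mU := measurable_frequency.
have mU2 : measurable_fun setT (EFin \o (fun w => frequency F w ^+ 2)).
  by apply/measurable_EFinP; exact: measurable_funX.
have mV : measurable_fun setT (EFin \o (fun w => (frequency F w - a) ^+ 2)).
  by apply/measurable_EFinP; apply: measurable_funX; exact: measurable_funB.
have m2 : measurable_fun setT (EFin \o (fun w => 2 * a * frequency F w)).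
  by apply/measurable_EFinP; exact: measurable_funM.
have e : (\int[P]_w ((frequency F w - a) ^+ 2)%:E + (2 * a * a)%:E =
          \int[P]_w (frequency F w ^+ 2)%:E + (a ^+ 2)%:E)%E.
  transitivity (\int[P]_w (((frequency F w - a) ^+ 2)%:E + (2 * a * frequency F w)%:E))%E.
    rewrite ge0_integralD//; first last.
    - by move=> w _; rewrite lee_fin mulr_ge0 ?frequency_ge0// mulr_ge0.
    - by move=> w _; rewrite lee_fin sqr_ge0.
    congr (_ + _)%E; under [RHS]eq_integral do rewrite EFinM.
    rewrite ge0_integralZl_EFin//; last 3 first.
    - by move=> w _; rewrite lee_fin frequency_ge0.
    - exact/measurable_EFinP.
    - by rewrite mulr_ge0.
    by rewrite integral_frequency aE.
  transitivity (\int[P]_w ((frequency F w ^+ 2)%:E + (a ^+ 2)%:E))%E.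
    by apply: eq_integral => w _; rewrite -!EFinD; congr _%:E; ring.
  rewrite ge0_integralD//; first last.
  - by move=> w _; rewrite lee_fin sqr_ge0.
  - by move=> w _; rewrite lee_fin sqr_ge0.
  by rewrite integral_probability_cst.
have := leeD2r (a ^+ 2)%:E integral_frequency_sqr.
rewrite -e -EFinD => h.
rewrite -(@leeD2rE _ (2 * a * a)%:E)//; apply: le_trans h _.
by rewrite -EFinD lee_fin; lra.
Qed.

(** The first bound is better for the cells that are too light to be seen by
    a sample of size [N]. *)
Lemma mean_deviation_le :
  (\int[P]_w (`|frequency F w - fine (mu F)|)%:E <=
    (Num.min (2 * fine (mu F)) (Num.sqrt (fine (mu F) / N%:R)))%:E)%E.
Proof.
rewrite -/a EFin_min le_min; apply/andP; split.
  apply: (@le_trans _ _ (\int[P]_w ((frequency F w)%:E + a%:E))%E).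
    apply: ge0_le_lower_integral => w; rewrite ?lee_fin//.
    apply: le_trans (ler_normB _ _) _.
    by rewrite !ger0_norm// frequency_ge0.
  rewrite ge0_integralD//; first last.
  - exact/measurable_EFinP/measurable_frequency.
  - by move=> w _; rewrite lee_fin frequency_ge0.
  by rewrite integral_frequency integral_probability_cst aE -EFinD lee_fin; lra.
have [az|az] := eqVneq a 0.
  rewrite az mul0r sqrtr0; under eq_integral do rewrite subr0 ger0_norm ?frequency_ge0//.
  by rewrite integral_frequency aE az.
have v0 : 0 < a / N%:R by rewrite divr_gt0 ?ltr0n// lt_neqAle eq_sym az.
set t := Num.sqrt _; have t0 : 0 < t by rewrite sqrtr_gt0.
(* |x| <= (x ^ 2 / t + t) / 2, with equality at the typical size t of x *)
apply: (@le_trans _ _ (\int[P]_w ((2 * t)^-1%:E * ((frequency F w - a) ^+ 2)%:E + (t / 2)%:E))%E).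
  apply: ge0_le_lower_integral => w; first by rewrite lee_fin.
  rewrite -EFinM -EFinD lee_fin.
  set x := frequency F w - a.
  have -> : (2 * t)^-1 * x ^+ 2 + t / 2 = `|x| + (2 * t)^-1 * (`|x| - t) ^+ 2.
    rewrite -[x ^+ 2]real_normK ?num_real//; field; rewrite gt_eqF//.
  by rewrite lerDl mulr_ge0 ?sqr_ge0// invr_ge0 mulr_ge0// ltW.
have mV : measurable_fun setT (EFin \o (fun w => (frequency F w - a) ^+ 2)).
  apply/measurable_EFinP; apply: measurable_funX; apply: measurable_funB => //.
  exact: measurable_frequency.
have t20 : 0 <= (2 * t)^-1 by rewrite invr_ge0 mulr_ge0// ltW.
rewrite ge0_integralD//; first last.
- by move=> w _; rewrite lee_fin divr_ge0// ltW.
- by apply: emeasurable_funM.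
- by move=> w _; rewrite -EFinM lee_fin mulr_ge0// sqr_ge0.
rewrite ge0_integralZl_EFin//; last by move=> w _; rewrite lee_fin sqr_ge0.
rewrite integral_probability_cst.
have := lee_wpmul2l (t20 : (0 <= (2 * t)^-1%:E)%E) variance_frequency.
move=> /(leeD2r (t / 2)%:E) /le_trans; apply.
rewrite -EFinM -EFinD lee_fin -[a / _]sqr_sqrtr ?(ltW v0)// -/t.
by rewrite le_eqVlt; apply/orP; left; apply/eqP; field; rewrite gt_eqF.
Qed.

End empirical_deviation.

(** * Mean transport cost *)

Section upper_mean.
Context {dO : measure_display} {O : measurableType dO} {R : realType}.
Context (P : probability O R).
Implicit Types (f g : O -> R) (a b c : R).

(** A bound on the mean, bundled with the conditions under which such bounds may
    be added. *)
Definition mean_le f b : Prop :=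
  [/\ measurable_fun setT f, forall w, 0 <= f w & (\int[P]_w (f w)%:E <= b%:E)%E].

Lemma mean_le_cst c : 0 <= c -> mean_le (fun=> c) c.
Proof. by move=> c0; split=> //; rewrite integral_probability_cst. Qed.

Lemma mean_leD f g a b : mean_le f a -> mean_le g b -> mean_le (f \+ g) (a + b).
Proof.
move=> [mf f0 fa] [mg g0 gb]; split=> [|w|].
- exact: measurable_funD.
- by rewrite addr_ge0.
- rewrite (eq_integral (fun w => (f w)%:E + (g w)%:E)%E)//.
  rewrite ge0_integralD//.
  + by rewrite EFinD leeD.
  + by move=> w _; rewrite lee_fin.
  + exact/measurable_EFinP.
  + by move=> w _; rewrite lee_fin.
  + exact/measurable_EFinP.
Qed.

Lemma mean_leZ c f b : 0 <= c -> mean_le f b -> mean_le (fun w => c * f w) (c * b).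
Proof.
move=> c0 [mf f0 fb]; split=> [|w|].
- exact: measurable_funM.
- by rewrite mulr_ge0.
- under eq_integral do rewrite EFinM.
  rewrite ge0_integralZl_EFin//.
  + by rewrite EFinM lee_wpmul2l.
  + by move=> w _; rewrite lee_fin.
  + exact/measurable_EFinP.
Qed.

Lemma mean_le_sum (I : Type) (r : seq I) (f : I -> O -> R) (b : I -> R) :
  (forall i, mean_le (f i) (b i)) ->
  mean_le (fun w => \sum_(i <- r) f i w) (\sum_(i <- r) b i).
Proof.
move=> fb; elim: r => [|i r IH].
  under [X in mean_le X]eq_fun do rewrite big_nil.
  by rewrite big_nil; exact: mean_le_cst.
under [X in mean_le X]eq_fun do rewrite big_cons.
by rewrite big_cons; exact: mean_leD.
Qed.

End upper_mean.

Section mean_cost.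
Context {dO : measure_display} {O : measurableType dO} {R : realType} {d : nat}.
Context (P : probability O R) (X : nat -> {RV P >-> d.-tuple R}).
Variables (mu : probability (d.-tuple R) R) (N : nat) (p s : R) (m : nat).
Hypothesis XP : iid_with_law X mu.
Hypothesis p0 : 0 < p.
Hypothesis s0 : 0 < s.

Notation label_type := ('I_m.+2 * {ffun 'I_d -> 'I_(2 ^ m.+1).+1})%type.

Let class_mass_fiber (l : probability (d.-tuple R) R) k (c : label_type) :
  (class_mass (coarsen k) (cell_mass s l) c)%:E =
  l [set x | coarsen k (label s m x) == c].
Proof.
have mlab := @measurable_label R d s m s0.
have := measure_fibers l mlab measurableT (fun i => coarsen k i == c).
rewrite setTI => ->; rewrite /class_mass -sumEFin; apply: eq_bigr => i _.
by rewrite setTI fineK// fin_num_measure.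
Qed.

Let measurable_class k (c : label_type) :
  measurable [set x | coarsen k (label s m x) == c].
Proof.
rewrite (_ : [set x | _] =
  \bigcup_(i in [set i | coarsen k i == c]) (label s m @^-1` [set i])); last first.
  by apply/seteqP; split => [x /= xc|x [i /= ic xi]]; [exists (label s m x)|rewrite /= xi].
apply: fin_bigcup_measurable => // i _; exact: measurable_label.
Qed.

Let nu w : probability (d.-tuple R) R :=
  empirical_probability (R := R) (fun k => X k w) N.

Let nuE w F : nu w F = (frequency X N.+1 F w)%:E.
Proof. exact: empirical_measure_frequency. Qed.

Let cell_mass_nu w (c : label_type) :
  cell_mass s (nu w) c = frequency X N.+1 (label s m @^-1` [set c]) w.
Proof. exact: (congr1 fine (nuE w (label s m @^-1` [set c]))). Qed.

Let class_mass_nu w k (c : label_type) :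
  class_mass (coarsen k) (cell_mass s (nu w)) c =
  frequency X N.+1 [set x | coarsen k (label s m x) == c] w.
Proof. by apply: EFin_inj; exact: etrans (class_mass_fiber (nu w) k c) (nuE w _). Qed.

Let integral_nu w (h : d.-tuple R -> R) : measurable_fun setT h ->
  (forall x, 0 <= h x) ->
  (\int[nu w]_x (h x)%:E = (\sum_(k < N.+1) N.+1%:R^-1 * h (X k w))%:E)%E.
Proof.
move=> mh h0; have mh' : measurable_fun setT (EFin \o h) by exact/measurable_EFinP.
rewrite /nu/= /empirical_probability /empirical_measure.
rewrite ge0_integral_mscale//; last by move=> x _; rewrite lee_fin.
rewrite ge0_integral_measure_sum//; last by move=> x _; rewrite lee_fin.
rewrite -mulr_sumr EFinM -sumEFin; congr (_ * _)%E; apply: eq_bigr => k _.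
by rewrite integral_dirac// diracT mul1e.
Qed.

Definition cell_deviation k (c : label_type) : R :=
  let a := class_mass (coarsen k) (cell_mass s mu) c in
  Num.min (2 * a) (Num.sqrt (a / N.+1%:R)).

(** The multiscale bound holds for every outcome; its mean only involves the
    deviations of the frequencies of the cells. *)
Lemma mean_transport_cost_le (H : R) :
  (\int[mu]_x (far_cost p s m x)%:E <= H%:E)%E ->
  (\int[P]_w transport_cost p (empirical_measure R (fun k => X k w) N.+1) mu <=
    (\sum_(c : label_type) shell_cost p s m (d := d) c.1 / (2 `^ p) ^+ m * (2 * cell_mass s mu c) +
     \sum_(k < m.+1) \sum_(c : label_type) cell_cost p s k c * cell_deviation k c +
     2 * H)%:E)%E.
Proof.
move=> muH.
have H0 : 0 <= H.
  rewrite -lee_fin; apply: le_trans muH; apply: integral_ge0 => x _.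
  by rewrite lee_fin far_cost_ge0.
have m_ge0 c : 0 <= cell_mass s mu c by rewrite fine_ge0.
pose A w : R := \sum_(c : label_type) shell_cost p s m (d := d) c.1 / (2 `^ p) ^+ m *
  (frequency X N.+1 (label s m @^-1` [set c]) w + cell_mass s mu c).
pose B w : R := \sum_(k < m.+1) \sum_(c : label_type) cell_cost p s k c *
  `|frequency X N.+1 [set x | coarsen k (label s m x) == c] w -
    class_mass (coarsen k) (cell_mass s mu) c|.
pose G w : R := \sum_(k < N.+1) N.+1%:R^-1 * far_cost p s m (X k w).
have meanA : mean_le P A (\sum_(c : label_type) shell_cost p s m (d := d) c.1 / (2 `^ p) ^+ m *
    (2 * cell_mass s mu c)).
  apply: mean_le_sum => c; apply: mean_leZ.
    by rewrite divr_ge0 ?shell_cost_ge0// exprn_ge0// powR_ge0.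
  rewrite mulr_natl mulr2n; apply: mean_leD; last exact: mean_le_cst.
  have mc := @measurable_label R d s m s0 c; split.
  - exact: measurable_frequency.
  - by move=> w; exact: frequency_ge0.
  - by rewrite (integral_frequency XP)// fineK// fin_num_measure.
have meanB : mean_le P B (\sum_(k < m.+1) \sum_(c : label_type) cell_cost p s k c * cell_deviation k c).
  apply: mean_le_sum => k; apply: mean_le_sum => c; apply: mean_leZ.
    exact: cell_cost_ge0.
  have aE : class_mass (coarsen k) (cell_mass s mu) c =
      fine (mu [set x | coarsen k (label s m x) == c]) by rewrite -class_mass_fiber.
  split.
  - apply: measurableT_comp => //; apply: measurable_funB => //.
    exact: measurable_frequency.
  - by [].
  - by rewrite /cell_deviation aE; exact: mean_deviation_le.
have meanG : mean_le P G H.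
  have mfar := @measurable_far_cost R d p s m.
  have -> : H = \sum_(k < N.+1) N.+1%:R^-1 * H.
    by rewrite sumr_const card_ord -[_ *+ N.+1]mulr_natl mulrA divff ?mul1r// pnatr_eq0.
  apply: mean_le_sum => k; apply: mean_leZ => //; split.
  - exact: (measurableT_comp mfar).
  - by move=> w; exact: far_cost_ge0.
  - have far0 (y : d.-tuple R) : (0 <= (EFin \o far_cost p s m) y :> \bar R)%E.
      by rewrite lee_fin far_cost_ge0.
    have mfar' : measurable_fun setT (EFin \o @far_cost R d p s m).
      exact/measurable_EFinP.
    have := ge0_integral_distribution (X k) mfar' far0.
    rewrite /= => <-; rewrite (eq_measure_integral mu)// => F mF _.
    exact: XP.2.
have total := mean_leD (mean_leD (mean_leD meanA meanB) meanG) (mean_le_cst P H0).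
case: total => _ _; rewrite -addrA -mulr2n mulr_natl => /(le_trans _); apply.
apply: ge0_le_lower_integral => w.
  apply: le_ereal_inf_tmp => _ [xi _ <-]; apply: integral_ge0 => z _.
  by rewrite lee_fin powR_ge0.
have mfar := @measurable_far_cost R d p s m.
have far0 := @far_cost_ge0 R d p s m.
have := transport_cost_multiscale m p0 s0 (nu w) mu.
rewrite integral_nu// -/(G w) => /le_trans; apply.
rewrite (_ : (_ + _)%R = A w + B w); last first.
  rewrite /A /B; congr (_ + _).
    by apply: eq_bigr => c _; rewrite cell_mass_nu.
  by apply: eq_bigr => k _; apply: eq_bigr => c _; rewrite class_mass_nu.
by apply: le_trans (leeD2l _ muH) _; rewrite -!EFinD.
Qed.
End mean_cost.

(** * Masses of the cells *)

(** By the Cauchy-Schwarz inequality, here in the form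
    [sqrt y <= (y / t + t) / 2] with the best [t], the second bound involves the
    number of cells that may be charged. *)
Lemma sum_deviation_le (R : realType) (J : finType) (a : J -> R) (Q : pred J)
    (B c N : R) :
  (forall j, 0 <= a j) -> (forall j, ~~ Q j -> a j = 0) -> \sum_j a j <= B ->
  #|Q|%:R <= c -> 0 < B -> 0 < c -> 0 < N ->
  \sum_j Num.min (2 * a j) (Num.sqrt (a j / N)) <=
  Num.min (2 * B) (Num.sqrt (c * B / N)).
Proof.
move=> a0 aQ aB Qc B0 c0 N0; rewrite le_min; apply/andP; split.
  apply: (@le_trans _ _ (\sum_j 2 * a j)).
    by apply: ler_sum => j _; rewrite ge_min lexx.
  by rewrite -mulr_sumr ler_pM2l.
set t := Num.sqrt (B / (N * c)).
have t0 : 0 < t by rewrite sqrtr_gt0 divr_gt0// mulr_gt0.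
have tt : t ^+ 2 = B / (N * c) by rewrite sqr_sqrtr// divr_ge0 ?mulr_ge0 ?ltW.
have -> : Num.sqrt (c * B / N) = c * t.
  rewrite -[RHS]ger0_norm ?mulr_ge0 ?ltW// -sqrtr_sqr exprMn tt.
  by congr Num.sqrt; field; rewrite !gt_eqF.
apply: (@le_trans _ _ (\sum_(j | Q j) (a j / (N * t) + t) / 2)).
  rewrite [leRHS]big_mkcond/=; apply: ler_sum => j _; rewrite ge_min; apply/orP; right.
  case: ifPn => [_|/aQ ->]; last by rewrite mul0r sqrtr0.
  have y0 : 0 <= a j / N by rewrite divr_ge0// ltW.
  set x := Num.sqrt (a j / N).
  have -> : a j / (N * t) = x ^+ 2 / t by rewrite sqr_sqrtr// invfM mulrA.
  rewrite -subr_ge0 (_ : _ - x = (x - t) ^+ 2 / (2 * t)).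
    by rewrite divr_ge0 ?sqr_ge0// mulr_ge0// ltW.
  by field; rewrite gt_eqF.
rewrite -mulr_suml big_split/= -mulr_suml ler_pdivrMr// mulrDr mulr1.
apply: lerD.
  rewrite ler_pdivrMr ?mulr_gt0// (_ : c * t * _ = B); last first.
    rewrite (_ : c * t * (N * t) = N * c * t ^+ 2); last by ring.
    by rewrite tt; field; rewrite !gt_eqF.
  by apply: le_trans aB; rewrite [leRHS](bigID Q)/= lerDl sumr_ge0.
by rewrite sumr_const -[t *+ _]mulr_natl ler_wpM2r// ltW.
Qed.

Lemma big_pair_fst (V : Type) (idx : V) (op : Monoid.com_law idx) (I J : finType)
    (i0 : I) (F : I * J -> V) :
  \big[op/idx]_(c | c.1 == i0) F c = \big[op/idx]_j F (i0, j).
Proof.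
transitivity (\big[op/idx]_(c : I * J | (c.1 == i0) && xpredT c.2) F (c.1, c.2)).
  by apply: eq_big => [c|[]//]; rewrite andbT.
by rewrite -(pair_big (fun i => i == i0) xpredT (fun i j => F (i, j)))/= big_pred1_eq.
Qed.

Section moment_bounds.
Context {R : realType} {d : nat} (mu : probability (d.-tuple R) R).
Variables (p q s : R) (m : nat).
Hypothesis p0 : 0 < p.
Hypothesis pq : p < q.
Hypothesis s0 : 0 < s.
Hypothesis mom : (moment q mu <= (s `^ q)%:E)%E.

Notation label_type := ('I_m.+2 * {ffun 'I_d -> 'I_(2 ^ m.+1).+1})%type.

Let q0 : 0 < q. Proof. exact: lt_trans pq. Qed.

Let measurable_normX r :
  measurable_fun setT (EFin \o (fun x : d.-tuple R => eucl_norm x `^ r)).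
Proof.
apply/measurable_EFinP; apply: (measurableT_comp (measurable_powR r)).
exact: measurable_eucl_norm.
Qed.

Let measurable_far r : measurable [set x : d.-tuple R | r < eucl_norm x].
Proof.
rewrite (_ : [set y | _] = ~` [set y | eucl_norm y <= r]).
  exact: measurableC (measurable_norm_ball _).
by apply/seteqP; split => y /=; rewrite ltNge => /negP.
Qed.

Lemma markov_norm r : 0 < r ->
  fine (mu [set x | r < eucl_norm x]) <= (s / r) `^ q.
Proof.
move=> r0; have mr := measurable_far r; set A := [set x | _] in mr *.
have rq : 0 < r `^ q by rewrite powR_gt0.
have fin : mu A \is a fin_num by rewrite fin_num_measure.
rewrite powRM ?(ltW s0) ?invr_ge0 ?(ltW r0)//.
rewrite -powR_inv1 ?(ltW r0)// -powRrM mulN1r powRN ler_pdivlMr// mulrC.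
rewrite -lee_fin EFinM fineK//; apply: le_trans mom.
rewrite -(setIT A) -integral_indic// -ge0_integralZl_EFin//; first last.
- by rewrite ltW.
- by apply/measurable_EFinP; exact: measurable_indic.
apply: ge0_le_lower_integral => x; first by rewrite -EFinM lee_fin mulr_ge0 ?powR_ge0// indicE.
rewrite -EFinM lee_fin indicE; have [/set_mem/= rx|_] := boolP (x \in A).
  by rewrite mulr1 ge0_ler_powR ?nnegrE ?eucl_norm_ge0// ltW.
by rewrite mulr0 powR_ge0.
Qed.

(** If [|x| > r] then [|x| ^ p <= r ^ (p - q) * |x| ^ q]. *)
Lemma integral_far_cost_le :
  (\int[mu]_x (far_cost p s m x)%:E <=
    (2 `^ p * d%:R `^ p * s `^ p * 2 `^ (- ((q - p) * m%:R)))%:E)%E.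
Proof.
set r := s * 2 ^+ m; have r0 : 0 < r by rewrite mulr_gt0 ?exprn_gt0.
set K := 2 `^ p * d%:R `^ p; have K0 : 0 <= K by rewrite mulr_ge0 ?powR_ge0.
have rpq0 : 0 <= r `^ (p - q) by exact: powR_ge0.
apply: (@le_trans _ _ (\int[mu]_x ((K * r `^ (p - q))%:E * (eucl_norm x `^ q)%:E))%E).
  apply: ge0_le_lower_integral => x; first by rewrite lee_fin far_cost_ge0.
  rewrite -EFinM lee_fin /far_cost -/K -[leRHS]mulrA ler_wpM2l// -/r indicE.
  have [/set_mem/= rx|_] := boolP (x \in _); last by rewrite mulr0 mulr_ge0 ?powR_ge0.
  have x0 : 0 < eucl_norm x by exact: lt_trans rx.
  have -> : eucl_norm x `^ p = eucl_norm x `^ (p - q) * eucl_norm x `^ q.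
    by rewrite -powRD ?subrK// (gt_eqF x0) implybT.
  rewrite mulr1 ler_wpM2r ?powR_ge0//.
  rewrite (_ : p - q = - (q - p)); last by rewrite opprB.
  rewrite !powRN lef_pV2 ?posrE ?powR_gt0//.
  by rewrite ge0_ler_powR ?nnegrE ?subr_ge0// ltW.
rewrite ge0_integralZl_EFin//; first last.
- by rewrite mulr_ge0.
- exact: measurable_normX.
- by move=> x _; rewrite lee_fin powR_ge0.
apply: (@le_trans _ _ ((K * r `^ (p - q))%:E * (s `^ q)%:E)%E).
  by apply: lee_wpmul2l => //; rewrite lee_fin mulr_ge0.
rewrite -EFinM lee_fin -!mulrA !ler_wpM2l ?powR_ge0//.
rewrite /r powRM ?(ltW s0)// ?exprn_ge0// mulrAC -powRD; last by rewrite (gt_eqF s0) implybT.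
rewrite subrK ler_wpM2l ?powR_ge0// -powR_mulrn// -powRrM.
by rewrite (_ : m%:R * (p - q) = - ((q - p) * m%:R))//; ring.
Qed.

Lemma cell_mass_ge0 (c : label_type) : 0 <= cell_mass s mu c.
Proof. by rewrite fine_ge0. Qed.

Let mass_le1 (A : set (d.-tuple R)) : measurable A -> fine (mu A) <= 1.
Proof.
move=> mA; rewrite -lee_fin fineK ?fin_num_measure//; exact: probability_le1.
Qed.

Lemma shell_mass_le (n : 'I_m.+2) : (n <= m)%N ->
  \sum_v cell_mass s mu ((n, v) : label_type) <= 2 `^ q * 2 `^ (- (q * n%:R)).
Proof.
move=> nm; have mlab := @measurable_label R d s m s0.
pose A := [set x : d.-tuple R | (label s m x).1 == n].
have mA : measurable A.
  rewrite (_ : A = \bigcup_(c in [set c : label_type | c.1 == n]) (label s m @^-1` [set c])).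
    by apply: fin_bigcup_measurable => // c _; exact: mlab.
  by apply/seteqP; split => [x /= xn|x [c cn xc]]; [exists (label s m x)|move: cn; rewrite -xc].
have -> : \sum_v cell_mass s mu ((n, v) : label_type) = fine (mu A).
  apply: EFin_inj; rewrite fineK ?fin_num_measure// -sumEFin.
  have := measure_fibers mu mlab measurableT (fun c => c.1 == n).
  rewrite setTI -/A => ->.
  rewrite big_pair_fst.
  by apply: eq_bigr => v _; rewrite setTI fineK// fin_num_measure.
have [n0|n0] := posnP n.
  rewrite n0 mulr0 oppr0 powRr0 mulr1; apply: le_trans (mass_le1 mA) _.
  by rewrite -[leLHS](powRr0 2) ler_powR ?ler1n// ltW.
have r0 : 0 < s * 2 ^+ n.-1 by rewrite mulr_gt0 ?exprn_gt0.
apply: (@le_trans _ _ (fine (mu [set x : d.-tuple R | s * 2 ^+ n.-1 < eucl_norm x]))).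
  apply: fine_le; rewrite ?fin_num_measure//.
  apply: le_measure; rewrite ?inE// => x /= /eqP/(congr1 val)/=.
  rewrite inordK ?ltnS ?shell_le// => xn; rewrite ltNge -(shell_leE s0 (m := m)) ?xn; lia.
apply: le_trans (markov_norm r0) _.
rewrite invfM mulrA divff ?gt_eqF// mul1r -exprVn -powR_inv1// -powR_mulrn ?powR_ge0//.
rewrite -!powRrM -powRD ?pnatr_eq0 ?implybT// ler_powR ?ler1n//.
rewrite -[in leRHS](prednK n0) -natr1 le_eqVlt; apply/orP; left; apply/eqP.
by ring.
Qed.

Let C := 2 `^ q * 3 ^+ d * 2 : R.

(** The cells of a shell at level [m - k] have positions between [0] and
    [2 ^ (m - k).+1] along each axis, so there are at most
    [(3 * 2 ^ (m - k)) ^ d] of them. *)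
Lemma shell_deviation_le N (n : 'I_m.+2) k : (n <= m)%N -> (k <= m)%N ->
  \sum_v cell_deviation mu N s k ((n, v) : label_type) <=
  C * Num.min (2 `^ (- (q * n%:R)))
        (2 `^ ((d%:R * (m - k)%:R - q * n%:R) / 2) * N.+1%:R `^ (- (1 / 2))).
Proof.
move=> nm km.
pose a v := class_mass (coarsen k) (cell_mass s mu) ((n, v) : label_type).
pose b : nat := (2 ^ (m - k).+1)%N.
pose Q (v : {ffun 'I_d -> 'I_(2 ^ m.+1).+1}) := [forall i, (v i <= b)%N].
pose B : R := 2 `^ q * 2 `^ (- (q * n%:R)).
pose c : R := (3 * 2 ^+ (m - k)) ^+ d.
have a0 v : 0 <= a v by apply: class_mass_ge0 => ?; exact: cell_mass_ge0.
have aQ v : ~~ Q v -> a v = 0.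
  rewrite negb_forall => /existsP[i]; rewrite -ltnNge => vi.
  rewrite /a /class_mass big_pred0// => e; apply/eqP; rewrite /coarsen km => -[_ ev].
  move: vi; rewrite -ev ffunE inordK; last first.
    exact: leq_ltn_trans (leq_div _ _) (ltn_ord _).
  rewrite ltnNge /b; case/negP.
  rewrite -(mulnK (2 ^ (m - k).+1) (_ : (0 < 2 ^ k)%N)) ?expn_gt0//.
  rewrite leq_div2r// -expnD (_ : ((m - k).+1 + k = m.+1)%N); last by lia.
  by rewrite -ltnS.
have aB : \sum_v a v <= B.
  apply: le_trans (shell_mass_le nm).
  rewrite le_eqVlt; apply/orP; left; apply/eqP.
  transitivity (class_mass (fun c : label_type => c.1) (cell_mass s mu) n).
    transitivity (class_mass (fst \o coarsen k) (cell_mass s mu) n).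
      by rewrite class_mass_comp big_pair_fst.
    by apply: eq_bigl => e; rewrite /= /coarsen km.
  by rewrite /class_mass big_pair_fst.
have Qc : #|Q|%:R <= c.
  pose small := [pred j : 'I_(2 ^ m.+1).+1 | (j <= b)%N].
  have -> : #|Q| = (#|small| ^ d)%N.
    rewrite -[in RHS](card_ord d) -card_ffun_on.
    by apply: eq_card => v; rewrite !inE; apply/forallP/ffun_onP.
  rewrite /c natrX lerXn2r ?nnegrE ?mulr_ge0 ?exprn_ge0//.
  have sb : (#|small| <= b.+1)%N.
    have f_inj : {in small &, injective (fun j : 'I_(2 ^ m.+1).+1 => inord j : 'I_b.+1)}.
      move=> i j; rewrite !inE => ib jb /(congr1 val)/=.
      by rewrite !inordK// => ij; exact: val_inj.
    by rewrite -(card_in_image f_inj) -[leqRHS]card_ord max_card.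
  apply: (@le_trans _ _ b.+1%:R); first by rewrite ler_nat.
  rewrite /b -natr1 natrX exprS.
  have : 1 <= 2 ^+ (m - k) :> R by rewrite exprn_ege1// ler1n.
  lra.
have B0 : 0 < B by rewrite mulr_gt0// powR_gt0.
have c0 : 0 < c by rewrite exprn_gt0// mulr_gt0// exprn_gt0.
have N0 : 0 < N.+1%:R :> R by rewrite ltr0n.
apply: le_trans (sum_deviation_le a0 aQ aB Qc B0 c0 N0) _.
have two x : 1 <= x -> Num.sqrt x <= x :> R.
  move=> x1; rewrite -[leRHS]ger0_norm ?(le_trans _ x1)// -sqrtr_sqr ler_wsqrtr//.
  by rewrite expr2 ler_peMr// (le_trans _ x1).
have q1 : 1 <= 2 `^ q by rewrite -[leLHS](powRr0 2) ler_powR ?ler1n// ltW.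
have d1 : 1 <= 3 ^+ d :> R by rewrite exprn_ege1// ler1n.
have C0 : 0 <= C by rewrite !mulr_ge0 ?powR_ge0 ?exprn_ge0.
rewrite minr_pMr// le_min !ge_min; apply/andP; split; apply/orP; [left|right].
  rewrite /B /C mulrA ler_wpM2r ?powR_ge0// [leLHS]mulrC ler_wpM2r//.
  by rewrite ler_peMr ?powR_ge0.
set e := 2 `^ _ * _; have e0 : 0 <= e by rewrite mulr_ge0 ?powR_ge0.
have sqr_powR x y : (x `^ y) ^+ 2 = x `^ (y * 2) :> R.
  by rewrite powRrM powR_mulrn ?powR_ge0.
have -> : c * B / N.+1%:R = (3 ^+ d * 2 `^ q) * e ^+ 2.
  rewrite /c /B /e [in RHS]exprMn !sqr_powR.
  rewrite (_ : - (1 / 2) * 2 = -1); last by field.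
  rewrite powR_inv1// (_ : _ / 2 * 2 = (m - k)%:R * d%:R + - (q * n%:R)); last by field.
  rewrite powRD; last by rewrite pnatr_eq0 implybT.
  by rewrite powRrM !powR_mulrn ?powR_ge0// exprMn; ring.
rewrite sqrtrM ?mulr_ge0 ?powR_ge0 ?exprn_ge0// sqrtr_sqr ger0_norm//.
rewrite ler_wpM2r// /C.
have P1 : 1 <= 3 ^+ d * 2 `^ q.
  by apply: le_trans d1 _; rewrite ler_peMr// (le_trans _ d1).
apply: le_trans (two _ P1) _; rewrite [X in _ <= X * 2]mulrC.
by rewrite ler_peMr ?ler1n// (le_trans _ P1).
Qed.

End moment_bounds.

(** * Sums of minima of two geometric sequences *)

Section geometric_sums.
Context {R : realType}.
Implicit Types (a b c x y p q d N : R) (m n l k : nat).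

Let e2 x : R := 2 `^ x.

Let e2D x y : e2 (x + y) = e2 x * e2 y.
Proof. by rewrite /e2 powRD// pnatr_eq0 implybT. Qed.

Let e2_gt0 x : 0 < e2 x. Proof. by rewrite /e2 powR_gt0. Qed.

Let e2_ge0 x : 0 <= e2 x. Proof. exact: ltW. Qed.

Let e2_le x y : x <= y -> e2 x <= e2 y.
Proof. by move=> xy; rewrite /e2 ler_powR// ler1n. Qed.

Let e20 : e2 0 = 1. Proof. by rewrite /e2 powRr0. Qed.

Let e2N_lt1 c : 0 < c -> e2 (- c) < 1.
Proof.
move=> c0; rewrite lt_neqAle -{2}e20 e2_le ?oppr_le0 ?ltW// andbT powR_eq1.
by rewrite gt_eqF ?ltr1n// ltNge ler0n/= oppr_eq0 gt_eqF.
Qed.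

Definition geom_const c : R := (1 - 2 `^ (- c))^-1.

Lemma geom_const_gt0 c : 0 < c -> 0 < geom_const c.
Proof. by move=> c0; rewrite invr_gt0 subr_gt0; exact: e2N_lt1. Qed.

Let geom_constE c : 0 < c -> geom_const c = 1 + e2 (- c) * geom_const c.
Proof.
move=> c0; have := e2N_lt1 c0; rewrite /geom_const -/(e2 (- c)) => h.
by field; rewrite gt_eqF// subr_gt0.
Qed.

Lemma geom_sum_le c m : 0 < c ->
  \sum_(k < m) 2 `^ (- (c * k%:R)) <= geom_const c.
Proof.
move=> c0; elim: m => [|m IH]; first by rewrite big_ord0 ltW// geom_const_gt0.
rewrite big_ord_recl/= mulr0 oppr0 powRr0 [leRHS]geom_constE// lerD2l.
rewrite (eq_bigr (fun k : 'I_m => e2 (- c) * 2 `^ (- (c * k%:R)))); last first.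
  by move=> k _; rewrite -e2D /e2; congr (_ `^ _); rewrite /bump/= add1n -natr1; ring.
by rewrite -mulr_sumr ler_wpM2l.
Qed.

Lemma geom_sum_above_le c x m : 0 < c ->
  \sum_(k < m | x < k%:R) 2 `^ (- (c * (k%:R - x))) <= geom_const c.
Proof.
move=> c0; elim: m x => [|m IH] x.
  by rewrite big_ord0 ltW// geom_const_gt0.
have [x0|x0] := ltP x 0.
  rewrite big_mkcond/=; apply: le_trans (geom_sum_le m.+1 c0).
  apply: ler_sum => k _; case: ifP => // _.
  by apply: e2_le; rewrite lerN2 ler_pM2l// lerBrDr gerDl ltW.
rewrite big_mkcond big_ord_recl/= ltNge x0/= add0r.
rewrite -big_mkcond/=; apply: le_trans (IH (x - 1)).
rewrite big_mkcond/= [leRHS]big_mkcond/=; apply: ler_sum => k _.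
rewrite /bump/= add1n -natr1 ltrBlDr.
by case: ifP => // _; apply: e2_le; rewrite lerN2 ler_pM2l//; lra.
Qed.

Lemma geom_sum_below_le c x m : 0 < c ->
  \sum_(k < m | k%:R <= x) 2 `^ (- (c * (x - k%:R))) <= geom_const c.
Proof.
move=> c0; have S0 := geom_const_gt0 c0.
have neg y n : y < 0 -> \sum_(k < n | k%:R <= y) 2 `^ (- (c * (y - k%:R))) = 0.
  move=> y0; rewrite big_pred0// => k; apply: negbTE.
  by rewrite -ltNge (lt_le_trans y0).
have [x0|x0] := ltP x 0; first by rewrite neg// ltW.
suff : \sum_(k < m | k%:R <= x) 2 `^ (- (c * (x - k%:R))) <=
       geom_const c * (1 - e2 (- (c * (x + 1)))).
  move=> /le_trans; apply; rewrite ler_piMr//; first exact: ltW.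
  by rewrite gerBl.
elim: m x x0 => [|m IH] x x0.
  rewrite big_ord0 mulr_ge0 ?(ltW S0)// subr_ge0 -e20 e2_le// oppr_le0.
  by rewrite mulr_ge0 ?(ltW c0)// addr_ge0.
rewrite big_mkcond big_ord_recl/= x0 subr0.
rewrite (eq_bigr (fun k : 'I_m => if k%:R <= x - 1 then 2 `^ (- (c * ((x - 1) - k%:R))) else 0)); last first.
  move=> k _; rewrite /bump/= add1n -natr1 lerBrDr; case: ifP => // _.
  by congr (_ `^ _); ring.
rewrite -big_mkcond/= -/(e2 _).
have -> : geom_const c * (1 - e2 (- (c * (x + 1)))) =
          e2 (- (c * x)) + geom_const c * (1 - e2 (- (c * x))).
  rewrite (_ : - (c * (x + 1)) = - c + - (c * x)); last by ring.
  have h : geom_const c * e2 (- c) = geom_const c - 1.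
    by rewrite [in RHS]geom_constE//; ring.
  by rewrite e2D mulrBr mulrA h; ring.
rewrite lerD2l; have [x1|x1] := ltP (x - 1) 0.
  rewrite neg// mulr_ge0 ?(ltW S0)// subr_ge0 -e20 e2_le// oppr_le0.
  by rewrite mulr_ge0 ?(ltW c0).
by have := IH _ x1; rewrite subrK.
Qed.

Lemma count_below_le x m : 0 <= x -> \sum_(k < m | k%:R <= x) (1 : R) <= x + 1.
Proof.
elim: m x => [|m IH] x x0; first by rewrite big_ord0 addr_ge0.
rewrite big_mkcond big_ord_recl/= x0 addrC lerD2r.
rewrite (eq_bigr (fun k : 'I_m => if k%:R <= x - 1 then 1 else 0)); last first.
  by move=> k _; rewrite /bump/= add1n -natr1 lerBrDr.
rewrite -big_mkcond/=; have [x1|x1] := ltP (x - 1) 0.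
  rewrite big_pred0// => k; apply: negbTE.
  by rewrite -ltNge (lt_le_trans x1).
by have := IH _ x1; rewrite subrK.
Qed.

(** The two geometric sequences cross at [x = (A - B) / (a + b)], where their
    common value is the right-hand side; the minimum decays geometrically on
    both sides of [x]. *)
Lemma min_geom_sum_le a b A B m : 0 < a -> 0 < b ->
  \sum_(k < m) Num.min (2 `^ (A - a * k%:R)) (2 `^ (B + b * k%:R)) <=
  (geom_const a + geom_const b) * 2 `^ ((b * A + a * B) / (a + b)).
Proof.
move=> a0 b0; set V := (_ / _); pose x := (A - B) / (a + b).
have ab0 : a + b != 0 by rewrite gt_eqF// addr_gt0.
rewrite (bigID (fun k : 'I_m => x < k%:R))/= mulrDl; apply: lerD.
  apply: (@le_trans _ _ (\sum_(k < m | x < k%:R) 2 `^ (- (a * (k%:R - x))) * e2 V)).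
    apply: ler_sum => k _; rewrite ge_min -/(e2 (- _)) -e2D; apply/orP; left.
    by apply: e2_le; rewrite le_eqVlt; apply/orP; left; apply/eqP; rewrite /x /V; field.
  by rewrite -mulr_suml ler_wpM2r// geom_sum_above_le.
apply: (@le_trans _ _ (\sum_(k < m | k%:R <= x) 2 `^ (- (b * (x - k%:R))) * e2 V)).
  rewrite (eq_bigl (fun k : 'I_m => k%:R <= x)); last by move=> k; rewrite -leNgt.
  apply: ler_sum => k _; rewrite ge_min -/(e2 (- _)) -e2D; apply/orP; right.
  by apply: e2_le; rewrite le_eqVlt; apply/orP; left; apply/eqP; rewrite /x /V; field.
by rewrite -mulr_suml ler_wpM2r// geom_sum_below_le.
Qed.

(** Here one of the two sequences is constant, and there are about [y / a] terms
    before the crossing point: this is the source of the logarithm in the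
    critical case [p = d / 2]. *)
Lemma min_const_sum_le a y m : 0 < a -> 0 <= y ->
  \sum_(k < m) Num.min (2 `^ (- (a * k%:R))) (2 `^ (- y)) <=
  (y / a + 1 + geom_const a) * 2 `^ (- y).
Proof.
move=> a0 y0; pose x := y / a.
rewrite (bigID (fun k : 'I_m => k%:R <= x))/= mulrDl; apply: lerD.
  apply: (@le_trans _ _ (\sum_(k < m | k%:R <= x) 1 * e2 (- y))).
    by apply: ler_sum => k _; rewrite mul1r ge_min lexx orbT.
  by rewrite -mulr_suml ler_wpM2r// count_below_le// divr_ge0// ltW.
apply: (@le_trans _ _ (\sum_(k < m | x < k%:R) 2 `^ (- (a * (k%:R - x))) * e2 (- y))).
  rewrite (eq_bigl (fun k : 'I_m => x < k%:R)); last by move=> k; rewrite -ltNge.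
  apply: ler_sum => k _; rewrite ge_min -/(e2 (- _)) -e2D; apply/orP; left.
  apply: e2_le; rewrite le_eqVlt; apply/orP; left; apply/eqP; rewrite /x.
  by field; rewrite gt_eqF.
by rewrite -mulr_suml ler_wpM2r// geom_sum_above_le.
Qed.

(** Up to a constant, the mean cost of moving the discrepancies between the
    cells of mesh [2 ^ (n - l)] of the [n]-th shell, whose mass is at most of
    order [2 ^ (- q n)] and which contains about [2 ^ (d l)] such cells. *)
Definition shell_level_term p q d N n l : R :=
  2 `^ (p * n%:R - p * l%:R) *
  Num.min (2 `^ (- (q * n%:R))) (2 `^ ((d * l%:R - q * n%:R) / 2) * N `^ (- (1 / 2))).

Let log2 N : R := ln N / ln 2.

Let powR_log2 N x : 1 <= N -> N `^ x = e2 (log2 N * x).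
Proof.
move=> N1; rewrite /e2 /powR pnatr_eq0/= gt_eqF ?(lt_le_trans _ N1)//.
by rewrite /log2; congr expR; field; rewrite gt_eqF// ln_gt0// ltr1n.
Qed.

Let log2_ge0 N : 1 <= N -> 0 <= log2 N.
Proof. by move=> N1; rewrite divr_ge0// ?ln_ge0// ler1n. Qed.

Let termE p q d N n l : 1 <= N -> shell_level_term p q d N n l =
  Num.min (e2 (p * n%:R - p * l%:R - q * n%:R))
    (e2 (p * n%:R - p * l%:R + (d * l%:R - q * n%:R - log2 N) / 2)).
Proof.
move=> N1; rewrite /shell_level_term (powR_log2 _ N1) -!/(e2 _) -e2D.
rewrite minr_pMr//.
by rewrite -!e2D; congr (Num.min (e2 _) (e2 _)); field.
Qed.

(** For a small moment exponent the shells are summed first. *)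
Let sum_small_q p q d N M L : 0 < p -> p < q -> 1 <= N ->
  q < 2 * p -> d * (q - p) < p * q ->
  \sum_(n < M) \sum_(l < L) shell_level_term p q d N n l <=
  (geom_const (q - p) + geom_const (p - q / 2)) *
    geom_const ((p * q - d * (q - p)) / q) * N `^ (- ((q - p) / q)).
Proof.
move=> p0 pq N1 q2p dq; rewrite exchange_big/=.
have q0 : 0 < q by exact: lt_trans pq.
have a0 : 0 < q - p by rewrite subr_gt0.
have b0 : 0 < p - q / 2 by lra.
set c := (_ / q); have c0 : 0 < c by rewrite divr_gt0// subr_gt0.
set K := _ + _; have K0 : 0 <= K by rewrite addr_ge0// ltW// geom_const_gt0.
apply: (@le_trans _ _ (\sum_(l < L) K * (2 `^ (- (c * l%:R)) * N `^ (- ((q - p) / q))))).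
  apply: ler_sum => l _.
  rewrite (eq_bigr (fun n : 'I_M => Num.min (2 `^ (- (p * l%:R) - (q - p) * n%:R))
     (2 `^ ((d / 2 - p) * l%:R - log2 N / 2 + (p - q / 2) * n%:R)))); last first.
    move=> n _; rewrite termE//.
    by congr (Num.min (2 `^ _) (2 `^ _)); field.
  apply: le_trans (min_geom_sum_le _ _ _ a0 b0) _.
  rewrite ler_wpM2l// (powR_log2 _ N1) -!/(e2 _) -e2D.
  apply: e2_le; rewrite le_eqVlt; apply/orP; left; apply/eqP; rewrite /c.
  rewrite (_ : q - p + (p - q / 2) = q / 2); last by field.
  by field; rewrite gt_eqF.
rewrite -mulr_sumr -mulr_suml -!mulrA ler_wpM2l// ler_wpM2r ?powR_ge0//.
exact: geom_sum_le.
Qed.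

(** For a large moment exponent and [p < d / 2] the levels are summed first. *)
Let sum_large_q p q d N M L : 0 < p -> p < q -> 1 <= N ->
  p < d / 2 -> d * p < q * (d - p) ->
  \sum_(n < M) \sum_(l < L) shell_level_term p q d N n l <=
  (geom_const p + geom_const (d / 2 - p)) *
    geom_const ((q * (d - p) - d * p) / d) * N `^ (- (p / d)).
Proof.
move=> p0 pq N1 pd dq.
have d0 : 0 < d by lra.
have b0 : 0 < d / 2 - p by lra.
set c := (_ / d); have c0 : 0 < c by rewrite divr_gt0// subr_gt0.
set K := _ + _; have K0 : 0 <= K by rewrite addr_ge0// ltW// geom_const_gt0.
apply: (@le_trans _ _ (\sum_(n < M) K * (2 `^ (- (c * n%:R)) * N `^ (- (p / d))))).
  apply: ler_sum => n _.
  rewrite (eq_bigr (fun l : 'I_L => Num.min (2 `^ ((p - q) * n%:R - p * l%:R))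
     (2 `^ ((p - q / 2) * n%:R - log2 N / 2 + (d / 2 - p) * l%:R)))); last first.
    move=> l _; rewrite termE//.
    by congr (Num.min (2 `^ _) (2 `^ _)); field.
  apply: le_trans (min_geom_sum_le _ _ _ p0 b0) _.
  rewrite ler_wpM2l// (powR_log2 _ N1) -!/(e2 _) -e2D.
  apply: e2_le; rewrite le_eqVlt; apply/orP; left; apply/eqP; rewrite /c.
  rewrite (_ : p + (d / 2 - p) = d / 2); last by field.
  by field; rewrite gt_eqF.
rewrite -mulr_sumr -mulr_suml -!mulrA ler_wpM2l// ler_wpM2r ?powR_ge0//.
exact: geom_sum_le.
Qed.

Let sum_large_p p q d N M L : 0 < p -> 1 <= N -> d / 2 < p -> 2 * p < q ->
  \sum_(n < M) \sum_(l < L) shell_level_term p q d N n l <=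
  geom_const (q / 2 - p) * geom_const (p - d / 2) * N `^ (- (1 / 2)).
Proof.
move=> p0 N1 pd qp.
have a0 : 0 < q / 2 - p by lra.
have b0 : 0 < p - d / 2 by lra.
apply: (@le_trans _ _ (\sum_(n < M) \sum_(l < L) 2 `^ (- ((q / 2 - p) * n%:R)) *
    (2 `^ (- ((p - d / 2) * l%:R)) * N `^ (- (1 / 2))))).
  apply: ler_sum => n _; apply: ler_sum => l _.
  rewrite termE// (powR_log2 _ N1) -!/(e2 _) -!e2D ge_min; apply/orP; right.
  by apply: e2_le; rewrite le_eqVlt; apply/orP; left; apply/eqP; field.
under eq_bigr do rewrite -mulr_sumr -mulr_suml.
rewrite -mulr_suml mulrA ler_wpM2r ?powR_ge0// ler_pM//.
- by apply: sumr_ge0 => ? _; exact: powR_ge0.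
- by apply: sumr_ge0 => ? _; exact: powR_ge0.
- exact: geom_sum_le.
- exact: geom_sum_le.
Qed.

Let ln2_gt0 : 0 < ln 2 :> R. Proof. by rewrite ln_gt0// ltr1n. Qed.

Let sum_critical p q d N M L : 0 < p -> 1 <= N -> p = d / 2 -> 2 * p < q ->
  \sum_(n < M) \sum_(l < L) shell_level_term p q d N n l <=
  geom_const (q / 2 - p) * (((2 * p)^-1 + 1 + geom_const p) / ln 2) *
    (N `^ (- (1 / 2)) * ln (1 + N)).
Proof.
move=> p0 N1 pd qp.
have a0 : 0 < q / 2 - p by lra.
have v0 := log2_ge0 N1.
apply: (@le_trans _ _ (\sum_(n < M) 2 `^ (- ((q / 2 - p) * n%:R)) *
    \sum_(l < L) Num.min (2 `^ (- (p * l%:R))) (2 `^ (- (log2 N / 2))))).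
  apply: ler_sum => n _; rewrite mulr_sumr; apply: ler_sum => l _.
  rewrite termE// minr_pMr ?powR_ge0// -!/(e2 _) -!e2D.
  have n0 : 0 <= n%:R :> R by [].
  have d2p : d = 2 * p by lra.
  rewrite le_min !ge_min; apply/andP; split; apply/orP; [left|right];
    apply: e2_le; rewrite ?d2p.
    have : 0 <= q / 2 * n%:R by rewrite mulr_ge0//; lra.
    by lra.
  by rewrite le_eqVlt; apply/orP; left; apply/eqP; field.
rewrite -mulr_suml -mulrA ler_pM ?geom_sum_le//.
- by apply: sumr_ge0 => ? _; exact: powR_ge0.
- by apply: sumr_ge0 => ? _; rewrite le_min !powR_ge0.
apply: le_trans (min_const_sum_le _ _ _) _ => //; first by rewrite divr_ge0.
rewrite (powR_log2 _ N1) (_ : log2 N * - (1 / 2) = - (log2 N / 2)); last by field.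
rewrite -!/(e2 _) [X in _ <= _ * X]mulrC mulrA ler_wpM2r//.
(* [ln (1 + N)] dominates both [ln N] and the constant [ln 2] *)
have lN : ln N <= ln (1 + N).
  by rewrite ler_ln ?posrE//; lra.
have l2 : ln 2 <= ln (1 + N).
  by rewrite ler_ln ?posrE//; lra.
have S0 := ltW (geom_const_gt0 p0).
rewrite [leRHS]mulrAC ler_pdivlMr//.
rewrite [leRHS]mulrDl [in leRHS]mulrDl [leLHS]mulrDl [in leLHS]mulrDl.
apply: lerD; last by rewrite ler_wpM2l.
apply: lerD; last by rewrite ler_wpM2l.
rewrite (_ : log2 N / 2 / p * ln 2 = (2 * p)^-1 * ln N).
  by rewrite ler_wpM2l// invr_ge0 mulr_ge0// ltW.
by rewrite /log2; field; rewrite !gt_eqF.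
Qed.

Lemma shell_level_sum_le p q d : 0 < d -> 0 < p -> p < q ->
  exists2 C, 0 <= C & forall N M L, 1 <= N ->
  let S := \sum_(n < M) \sum_(l < L) shell_level_term p q d N n l in
  [/\ d / 2 < p -> q != 2 * p ->
        S <= C * (N `^ (- (1 / 2)) + N `^ (- ((q - p) / q))),
      p = d / 2 -> q != 2 * p ->
        S <= C * (N `^ (- (1 / 2)) * ln (1 + N) + N `^ (- ((q - p) / q)))
    & p < d / 2 -> q != d * p / (d - p) ->
        S <= C * (N `^ (- (p / d)) + N `^ (- ((q - p) / q)))].
Proof.
move=> d0 p0 pq; have q0 : 0 < q by exact: lt_trans pq.
(* a constant can be negative outside of its own regime *)
pose K1 := (geom_const (q - p) + geom_const (p - q / 2)) *
    geom_const ((p * q - d * (q - p)) / q).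
pose K2 := (geom_const p + geom_const (d / 2 - p)) *
    geom_const ((q * (d - p) - d * p) / d).
pose K3 := geom_const (q / 2 - p) * geom_const (p - d / 2).
pose K4 := geom_const (q / 2 - p) * (((2 * p)^-1 + 1 + geom_const p) / ln 2).
exists (`|K1| + `|K2| + `|K3| + `|K4|); first by rewrite !addr_ge0.
move=> N M L N1 S; set C := _ + `|K4|.
have KC : [/\ K1 <= C, K2 <= C, K3 <= C & K4 <= C].
  have := ler_norm K1; have := ler_norm K2; have := ler_norm K3; have := ler_norm K4.
  have := normr_ge0 K1; have := normr_ge0 K2; have := normr_ge0 K3; have := normr_ge0 K4.
  by rewrite /C => *; split; lra.
have C0 : 0 <= C by rewrite !addr_ge0.
have [K1C K2C K3C K4C] := KC.
have left K x y : S <= K * x -> K <= C -> 0 <= x -> 0 <= y -> S <= C * (x + y).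
  move=> SK KC' x0 y0; apply: le_trans SK _.
  by apply: (le_trans (ler_wpM2r x0 KC')); rewrite ler_wpM2l// lerDl.
have right K x y : S <= K * x -> K <= C -> 0 <= x -> 0 <= y -> S <= C * (y + x).
  by move=> *; rewrite addrC; apply: (left K).
have l0 : 0 <= ln (1 + N) by rewrite ln_ge0//; lra.
split.
- move=> pd; rewrite neq_lt => /orP[q2p|q2p].
    apply: (right K1); rewrite ?powR_ge0//; apply: sum_small_q => //.
    nra.
  by apply: (left K3); rewrite ?powR_ge0//; apply: sum_large_p.
- move=> pd; rewrite neq_lt => /orP[q2p|q2p].
    apply: (right K1); rewrite ?powR_ge0 ?mulr_ge0 ?powR_ge0//; apply: sum_small_q => //.
    nra.
  by apply: (left K4); rewrite ?powR_ge0 ?mulr_ge0 ?powR_ge0//; apply: sum_critical.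
- move=> pd; have dp0 : 0 < d - p by lra.
  rewrite neq_lt ltr_pdivlMr// ltr_pdivrMr// => /orP[qd|qd].
    apply: (right K1); rewrite ?powR_ge0//; apply: sum_small_q => //; last by lra.
    nra.
  by apply: (left K2); rewrite ?powR_ge0//; apply: sum_large_q.
Qed.

End geometric_sums.

(** * The rate of convergence *)

Section rate.
Context {R : realType}.

Lemma big_pair_label (I J : finType) (F : I * J -> R) :
  \sum_c F c = \sum_i \sum_j F (i, j).
Proof.
rewrite (partition_big fst xpredT)//=; apply: eq_bigr => i _.
by rewrite big_pair_fst.
Qed.

Let powR_nat (x : R) n : (2 `^ x) ^+ n = 2 `^ (x * n%:R).
Proof. by rewrite powRrM powR_mulrn ?powR_ge0. Qed.

Let powR2D (x y : R) : 2 `^ x * 2 `^ y = 2 `^ (x + y).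
Proof. by rewrite powRD// pnatr_eq0 implybT. Qed.

Section fixed_scale.
Context {dO : measure_display} {O : measurableType dO} {d : nat}.
Context (P : probability O R) (X : nat -> {RV P >-> d.-tuple R}).
Variables (mu : probability (d.-tuple R) R) (N : nat) (p q s : R) (m : nat).
Hypothesis XP : iid_with_law X mu.
Hypothesis p0 : 0 < p.
Hypothesis pq : p < q.
Hypothesis s0 : 0 < s.
Hypothesis mom : (moment q mu <= (s `^ q)%:E)%E.

Notation label_type := ('I_m.+2 * {ffun 'I_d -> 'I_(2 ^ m.+1).+1})%type.

Let K : R := 2 `^ p * d%:R `^ p * s `^ p.
Let K0 : 0 <= K. Proof. by rewrite !mulr_ge0 ?powR_ge0. Qed.

Let shell_costE (n : 'I_m.+1) : shell_cost p s m (d := d) n = K * 2 `^ (p * n%:R).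
Proof. by rewrite /shell_cost -ltnS ltn_ord powR_nat. Qed.

Let shell_cost_out : shell_cost p s m (d := d) m.+1 = 0.
Proof. by rewrite /shell_cost ltnn. Qed.

(** The finest cells are so small that moving mass inside them costs nothing in
    the limit of large [m]. *)
Let finest_cost_le :
  \sum_(c : label_type) shell_cost p s m (d := d) c.1 / (2 `^ p) ^+ m * (2 * cell_mass s mu c) <=
  K * (2 * 2 `^ q * geom_const (q - p) * 2 `^ (- (p * m%:R))).
Proof.
rewrite big_pair_label big_ord_recr/= shell_cost_out [X in _ + X]big1 ?addr0; last first.
  by move=> v _; rewrite !mul0r.
apply: (@le_trans _ _ (\sum_(n < m.+1)
    K * (2 * 2 `^ q * 2 `^ (- (p * m%:R)) * 2 `^ (- ((q - p) * n%:R))))).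
  apply: ler_sum => n _; rewrite -mulr_sumr -mulr_sumr shell_costE.
  have nm : (widen_ord (leqnSn m.+1) n <= m)%N by rewrite /= -ltnS.
  have := shell_mass_le p0 pq s0 mom nm; rewrite /= => h.
  have c0 : 0 <= K * 2 `^ (p * n%:R) / (2 `^ p) ^+ m * 2.
    by rewrite mulr_ge0// divr_ge0 ?exprn_ge0 ?powR_ge0// mulr_ge0 ?powR_ge0.
  rewrite mulrA; apply: (le_trans (ler_wpM2l c0 h)).
  rewrite powR_nat -powRN -!mulrA ler_wpM2l//.
  rewrite (_ : 2 `^ (- ((q - p) * n%:R)) = 2 `^ (p * n%:R) * 2 `^ (- (q * n%:R))).
    by rewrite le_eqVlt; apply/orP; left; apply/eqP; ring.
  by rewrite powR2D; congr (_ `^ _); ring.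
rewrite -!mulr_sumr ler_wpM2l// [leRHS]mulrAC ler_wpM2l ?mulr_ge0 ?powR_ge0//.
by apply: geom_sum_le; rewrite subr_gt0.
Qed.

Let C : R := 2 `^ q * 3 ^+ d * 2.

(** The level [l = m - k] counts the subdivisions, whereas [k] counts the
    coarsenings. *)
Let discrepancy_cost_le :
  \sum_(k < m.+1) \sum_(c : label_type) cell_cost p s k c * cell_deviation mu N s k c <=
  K * (C * \sum_(n < m.+1) \sum_(l < m.+1) shell_level_term p q d%:R N.+1%:R n l).
Proof.
rewrite [in leRHS]exchange_big/= [in leRHS](reindex_inj rev_ord_inj)/= !mulr_sumr; apply: ler_sum => k _.
rewrite big_pair_label big_ord_recr/= [X in _ + X]big1 ?addr0; last first.
  by move=> v _; rewrite /cell_cost /= shell_cost_out !mul0r.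
rewrite !mulr_sumr; apply: ler_sum => n _; rewrite subSS.
have nm : (widen_ord (leqnSn m.+1) n <= m)%N by rewrite /= -ltnS.
have km : (k <= m)%N by rewrite -ltnS.
have := shell_deviation_le p0 pq s0 mom N nm km; rewrite -/C => h.
rewrite /cell_cost/= -mulr_sumr shell_costE.
have c0 : 0 <= K * 2 `^ (p * n%:R) * (2 `^ p) ^+ k / (2 `^ p) ^+ m.
  by rewrite divr_ge0 ?exprn_ge0 ?powR_ge0// !mulr_ge0 ?exprn_ge0 ?powR_ge0.
apply: (le_trans (ler_wpM2l c0 h)); rewrite !powR_nat -powRN -!mulrA ler_wpM2l//.
rewrite /shell_level_term.
rewrite (_ : p * n%:R - p * (m - k)%:R = p * n%:R + (p * k%:R + - (p * m%:R))); last first.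
  by rewrite natrB//; ring.
by rewrite -!powR2D le_eqVlt; apply/orP; left; apply/eqP; rewrite /=; ring.
Qed.

Lemma mean_transport_cost_le_sum :
  (\int[P]_w transport_cost p (empirical_measure R (fun k => X k w) N.+1) mu <=
    (K * (2 * 2 `^ q * geom_const (q - p) * 2 `^ (- (p * m%:R)) +
     C * \sum_(n < m.+1) \sum_(l < m.+1) shell_level_term p q d%:R N.+1%:R n l +
     2 * 2 `^ (- ((q - p) * m%:R))))%:E)%E.
Proof.
apply: le_trans (mean_transport_cost_le N XP p0 s0 (integral_far_cost_le m pq s0 mom)) _.
rewrite lee_fin !mulrDr [2 * (_ * _)]mulrCA lerD2r.
exact: lerD finest_cost_le discrepancy_cost_le.
Qed.

End fixed_scale.

Lemma exists_small_powR2 (c e : R) : 0 < c -> 0 < e ->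
  exists m : nat, 2 `^ (- (c * m%:R)) <= e.
Proof.
move=> c0 e0; have l2 : 0 < ln 2 :> R by rewrite ln_gt0// ltr1n.
exists (Num.truncn (- ln e / (c * ln 2))).+1.
set m := _.+1; have := truncnS_gt (- ln e / (c * ln 2)); rewrite -/m.
rewrite ltr_pdivrMr ?mulr_gt0// => h.
rewrite /powR pnatr_eq0/= -[leRHS]lnK ?posrE// ler_expR.
by rewrite mulNr lerNl; apply/ltW; apply: lt_le_trans h _;
  rewrite le_eqVlt; apply/orP; left; apply/eqP; ring.
Qed.

(** The number [m] of shells and levels is chosen so large, depending on [N], that
    the terms due to the truncation are below the rate. *)
Lemma mean_transport_cost_rate (d : nat) (p q : R) : (0 < d)%N -> 0 < p -> p < q ->
  exists2 C : R, 0 <= C &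
  forall (mu : probability (d.-tuple R) R) (s : R),
    0 < s -> (moment q mu <= (s `^ q)%:E)%E ->
  forall (dO : measure_display) (O : measurableType dO) (P : probability O R)
    (X : nat -> {RV P >-> d.-tuple R}), iid_with_law X mu ->
  forall N : nat,
  let M : R := N.+1%:R in
  let T := (\int[P]_w transport_cost p (empirical_measure R (fun k => X k w) N.+1) mu)%E in
  [/\ d%:R / 2 < p -> q != 2 * p ->
       (T <= (C * s `^ p * (M `^ (- (1 / 2)) + M `^ (- ((q - p) / q))))%:E)%E,
      p = d%:R / 2 -> q != 2 * p ->
       (T <= (C * s `^ p * (M `^ (- (1 / 2)) * ln (1 + M) + M `^ (- ((q - p) / q))))%:E)%E
    & p < d%:R / 2 -> q != d%:R * p / (d%:R - p) ->
       (T <= (C * s `^ p * (M `^ (- (p / d%:R)) + M `^ (- ((q - p) / q))))%:E)%E].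
Proof.
move=> d0 p0 pq; have dR0 : 0 < d%:R :> R by rewrite ltr0n.
have [C1 C10 sumC1] := shell_level_sum_le dR0 p0 pq.
have qp0 : 0 < q - p by rewrite subr_gt0.
have G0 := ltW (geom_const_gt0 qp0).
pose A : R := 2 * 2 `^ q * geom_const (q - p).
have A0 : 0 <= A by rewrite !mulr_ge0 ?powR_ge0.
pose C2 : R := 2 `^ q * 3 ^+ d * 2.
have C20 : 0 <= C2 by rewrite !mulr_ge0 ?powR_ge0 ?exprn_ge0.
exists (2 `^ p * d%:R `^ p * (A + C2 * C1 + 2)).
  by rewrite mulr_ge0 ?addr_ge0 ?mulr_ge0 ?powR_ge0.
move=> mu s s0 mom dO O P X XP N M T.
have M1 : 1 <= M by rewrite /M ler1n.
set e := M `^ (- ((q - p) / q)); have e0 : 0 < e by rewrite powR_gt0// (lt_le_trans _ M1).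
have [m mp] := exists_small_powR2 p0 e0.
have [m' mqp] := exists_small_powR2 qp0 e0.
pose L := maxn m m'.
have Lp : 2 `^ (- (p * L%:R)) <= e.
  apply: le_trans mp; rewrite ler_powR ?ler1n// lerN2 ler_pM2l// ler_nat.
  exact: leq_maxl.
have Lqp : 2 `^ (- ((q - p) * L%:R)) <= e.
  apply: le_trans mqp; rewrite ler_powR ?ler1n// lerN2 ler_pM2l// ler_nat.
  exact: leq_maxr.
have TL : (T <= _)%E := mean_transport_cost_le_sum N L XP p0 pq s0 mom.
have [S1 S2 S3] := sumC1 M L.+1 L.+1 M1.
set S := \sum_(n < L.+1) _ in S1 S2 S3.
have finish r : 0 <= r -> S <= C1 * (r + e) ->
    (T <= (2 `^ p * d%:R `^ p * (A + C2 * C1 + 2) * s `^ p * (r + e))%:E)%E.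
  move=> r0 Sr; apply: le_trans TL _; rewrite -/A -/C2 -/S lee_fin.
  rewrite [2 `^ p * _ * (_ + 2) * _]mulrAC -[leRHS]mulrA ler_wpM2l ?mulr_ge0 ?powR_ge0//.
  rewrite (_ : (A + C2 * C1 + 2) * (r + e) =
    A * (r + e) + C2 * (C1 * (r + e)) + 2 * (r + e)); last by ring.
  apply: lerD; first apply: lerD.
  - by rewrite ler_wpM2l//; apply: le_trans Lp _; rewrite lerDr.
  - by rewrite ler_wpM2l.
  - by rewrite ler_wpM2l//; apply: le_trans Lqp _; rewrite lerDr.
split=> h1 h2; apply: finish; rewrite ?powR_ge0//.
- exact: S1.
- by rewrite mulr_ge0 ?powR_ge0// ln_ge0//; lra.
- exact: S2.
- exact: S3.
Qed.

(** The bound is homogeneous in the length scale [s]; the natural choice is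
    [s = M ^ (1 / q)], and any [s > 0] is allowed when the moment [M]
    vanishes. *)
Lemma optimize_scale (p q C r : R) (M T : \bar R) :
  0 < p -> 0 < q -> 0 <= C -> 0 <= r -> (0 <= M)%E -> (M < +oo)%E ->
  (forall s, 0 < s -> (M <= (s `^ q)%:E)%E -> (T <= (C * s `^ p * r)%:E)%E) ->
  (T <= C%:E * M `^ (p / q) * r%:E)%E.
Proof.
move=> p0 q0 C0 r0 M0 Moo bd; case: M M0 Moo bd => // M M0 _ bd.
rewrite poweR_EFin -!EFinM; rewrite lee_fin in M0.
have inv_powR (x y : R) : 0 < y -> 0 <= x -> (x `^ y^-1) `^ y = x.
  by move=> y0 x0; rewrite -powRrM mulVf ?gt_eqF// powRr1.
move: M0; rewrite le_eqVlt => /predU1P[M0|M0].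
  rewrite -{}M0 in bd *.
  rewrite powR0 ?mulr0 ?mul0r ?mulf_neq0 ?invr_eq0 ?gt_eqF//.
  apply/lee_addgt0Pr => e e0; rewrite add0e.
  have D0 : 0 < C * r + 1 by rewrite ltr_wpDl// mulr_ge0.
  pose s := (e / (C * r + 1)) `^ p^-1.
  have s0 : 0 < s by rewrite powR_gt0// divr_gt0.
  have sq : (0%:E <= (s `^ q)%:E)%E by rewrite lee_fin powR_ge0.
  apply: le_trans (bd s s0 sq) _.
  rewrite lee_fin inv_powR//; last by rewrite divr_ge0 ?ltW.
  rewrite mulrAC mulrA ler_pdivrMr// mulrC ler_pM2l//.
  by rewrite lerDl.
have s0 : 0 < M `^ q^-1 by rewrite powR_gt0.
have := bd _ s0; rewrite inv_powR ?(ltW M0)// lexx => /(_ isT).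
by rewrite -powRrM [q^-1 * p]mulrC.
Qed.

End rate.

Theorem theorem1 (R : realType) (d : nat) (p q : R)
    (hd : (1 <= d)%N) (hp : 0 < p) (hpq : p < q) :
  exists C : R,
  forall mu : probability (d.-tuple R) R,
    (moment q mu < +oo)%E ->
  forall (dO : measure_display) (O : measurableType dO) (P : probability O R)
    (X : nat -> {RV P >-> d.-tuple R}),
    iid_with_law X mu ->
  forall N : nat, (1 <= N)%N ->
    let ET : \bar R := (\int[P]_w
      transport_cost p (empirical_measure R (fun k => X k w) N) mu)%E in
    let bound (rate : R) : \bar R :=
      (C%:E * moment q mu `^ (p / q) * rate%:E)%E in
    [/\ d%:R / 2 < p -> q != 2 * p ->
          (ET <= bound (N%:R `^ (- (1 / 2)) + N%:R `^ (- ((q - p) / q)))%R)%E,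
        p = d%:R / 2 -> q != 2 * p ->
          (ET <= bound (N%:R `^ (- (1 / 2)) * ln (1 + N%:R)
                        + N%:R `^ (- ((q - p) / q)))%R)%E
      & p < d%:R / 2 -> q != d%:R * p / (d%:R - p) ->
          (ET <= bound (N%:R `^ (- (p / d%:R))
                        + N%:R `^ (- ((q - p) / q)))%R)%E ].
Proof.
have [C C0 bd] := mean_transport_cost_rate hd hp hpq; exists C.
move=> mu mom dO O P X XP [//|N] _ ET bound.
have q0 : 0 < q by exact: lt_trans hpq.
have M0 : (0 <= moment q mu)%E.
  by apply: integral_ge0 => x _; rewrite lee_fin powR_ge0.
split=> h1 h2; apply: optimize_scale => //.
- by move=> s s0 ms; have [+ _ _] := bd mu s s0 ms _ _ P X XP N; exact.
- by rewrite addr_ge0 ?mulr_ge0 ?powR_ge0// ln_ge0// lerDl.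
- by move=> s s0 ms; have [_ + _] := bd mu s s0 ms _ _ P X XP N; exact.
- by move=> s s0 ms; have [_ _ +] := bd mu s s0 ms _ _ P X XP N; exact.
Qed.
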